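(* $\mathrm{OOO}^{VP}{+}\mathrm{CCM} \subseteq \mathrm{WMM}$; that is, for every number of processors $n$, every $n$-processor program and every initial state, every program behavior of the physical multiprocessor model $\mathrm{OOO}^{VP}{+}\mathrm{CCM}$ is also a program behavior of the memory model $\mathrm{WMM}$.
   Context: **Programs and conventions.** There are $n$ processors. Processor $i$ runs a fixed program: $\mathsf{fetch}(pc)$ gives the instruction at $pc$ (never modified). Instructions are: $\mathsf{Nm}$ (non-memory, e.g. ALU/branch: from its source registers and its PC it computes a next PC and a value for a destination register), $\mathsf{Ld}$ (an address is computed from source registers, the loaded value goes to a destination register), $\mathsf{St}$ (address and data are computed from source registers), and the fences $\mathsf{Commit}$ and $\mathsf{Reconcile}$. The next PC of a non-$\mathsf{Nm}$ instruction is determined by its PC alone. Each model is a nondeterministic transition system; a rule may fire atomically whenever its guard holds; an execution is a finite sequence of rule firings from the initial state. All models start with the same registers, PCs and memory values, with all buffers empty. $\epsilon$ means ''not available''. **CCM (write-back cache memory).** State: memory $m$ with $m[a]=\langle v,t\rangle$ (value and tag of the store that wrote it; initial values carry special tags different from the tags of all stores), and for each $i$ an unordered buffer $mrb[i]$. Processor $i$ calls $\mathsf{reqLd}(idx,a)$ or $\mathsf{reqSt}(a,v,t)$, which insert $\langle \mathsf{Ld},idx,a\rangle$ or $\langle\mathsf{St},a,v,t\rangle$ into $mrb[i]$. Rules: *CCM-Ld*: remove any $\langle\mathsf{Ld},idx,a\rangle$ from some $mrb[i]$ and call $\mathsf{respLd}(idx,v,t)$ of processor $i$, where $\langle v,t\rangle=m[a]$.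 *CCM-St*: remove any $\langle\mathsf{St},a,v,t\rangle$ from some $mrb[i]$, set $m[a]:=\langle v,t\rangle$, call $\mathsf{respSt}(a)$ of processor $i$. **$\mathrm{OOO}^{VP}$ (out-of-order processor).** State of each processor: PC register $pcr$, register file $rf$, reorder buffer $rob$, store buffer $sb$ (a list of entries $\langle a,v,t,iss\rangle$ ordered from oldest to youngest), and a bit vector $lf$ (initially all False). $rob$ is a list of unbounded length; each new entry gets an index larger than all indices ever used (younger = larger index; indices are never reused). An entry is $\langle pc,npc,ins,ex\rangle$ with $npc$ the (predicted) next PC and $ex\in\{\mathsf{Idle},\mathsf{Exe},\mathsf{ReEx},\mathsf{Done}\}$. The field $ins$ is $\langle\mathsf{Nm},op,srcs,dst,val\rangle$, or $\langle\mathsf{Ld},srcs,dst,a,v,t\rangle$ ($t$ = tag of the store read), or $\langle\mathsf{St},srcs,a,v,t\rangle$ ($t$ = globally unique tag assigned at fetch), or $\langle\mathsf{Commit}\rangle$, or $\langle\mathsf{Reconcile}\rangle$; the fields $val,a,v$ and the tag of a load are initially $\epsilon$. A source register of an entry is ready if the youngest older $rob$ entry writing that register has a non-$\epsilon$ value (possibly a predicted load value), or if no older entry writes it (then $rf$ is used); an entry is ready if all its source registers are. The commit slot is the oldest entry. Auxiliary operations. $\mathsf{flush}(idx,pc)$: delete all entries with index $\ge idx$, set $pcr:=pc$, and for each deleted $\mathsf{Ld}$ with $ex\in\{\mathsf{Exe},\mathsf{ReEx}\}$ set its $lf$ bit to True. $\mathsf{findBypass}(idx,a)$: search $rob$ from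 the entry just older than $idx$ to the oldest, then $sb$ from youngest to oldest; return $\langle v,t\rangle$ of the first executed store to $a$ found; return $\epsilon$ if a $\mathsf{Reconcile}$ is met first; return $\top$ if nothing is found. $\mathsf{findAffectedLd}(idx,a)$: search from index $idx+1$ to the youngest entry, stopping at the first $\mathsf{St}$ with computed address $a$; return the list (oldest first) of all $\mathsf{Ld}$ entries met with address $a$ and $ex\ne\mathsf{Idle}$. $\mathsf{findStaleLd}(idx,a,t)$: search from $idx+1$ to the youngest entry for the first $\mathsf{Ld}$ with address $a$, $ex=\mathsf{Done}$ and tag $t'\neq t$ and return its index; return $\top$ if there is none or if a $\mathsf{St}$ with computed address $a$ is met first. Rules: - *OOO-Fetch*: $ins=\mathsf{fetch}(pcr)$; choose a prediction $npc$ (arbitrary for $\mathsf{Nm}$, the correct next PC otherwise); append $\langle pcr,npc,ins,ex\rangle$ with $ex=\mathsf{Done}$ for fences and $\mathsf{Idle}$ otherwise; $pcr:=npc$. - *OOO-NmEx*: for a ready $\mathsf{Idle}$ $\mathsf{Nm}$ entry $idx$, compute $\langle nextpc,val\rangle$, store $val$, set the entry's next-PC field to $nextpc$ and $ex:=\mathsf{Done}$; if $nextpc$ differs from the old $npc$ then $\mathsf{flush}(idx+1,nextpc)$. - *OOO-LdAddr*: for a ready $\mathsf{Idle}$ $\mathsf{Ld}$ with address $\epsilon$, compute and record its address. - *OOO-LdPred*: for any $\mathsf{Ld}$ entry with $v=\epsilon$ and tag $\epsilon$, set $v$ to an arbitrary predicted value. - *OOO-LdBypass*: for a ready $\mathsf{Idle}$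 $\mathsf{Ld}$ at $idx$ with computed address $a$, current value $v$ and tag $\epsilon$, if $\mathsf{findBypass}(idx,a)=\langle res,t\rangle$ (neither $\epsilon$ nor $\top$): set value $res$, tag $t$, $ex:=\mathsf{Done}$; if $v\neq\epsilon$ and $v\ne res$ then $\mathsf{flush}(idx+1,npc)$. - *OOO-LdReq*: for a ready $\mathsf{Idle}$ $\mathsf{Ld}$ at $idx$ with computed address $a$ and tag $\epsilon$, if $\mathsf{findBypass}(idx,a)=\top$ and $\neg lf[idx]$: call $\mathsf{reqLd}(idx,a)$ and set $ex:=\mathsf{Exe}$. - *OOO-StEx*: for a ready $\mathsf{Idle}$ $\mathsf{St}$ at $idx$, compute address $a$ and data $v$, let $list=\mathsf{findAffectedLd}(idx,a)$, record $a,v$, set $ex:=\mathsf{Done}$; then for each $k$ in $list$ from oldest to youngest: if $rob[k].ex=\mathsf{Done}$ then $\mathsf{flush}(k,rob[k].pc)$ and stop, else $rob[k].ex:=\mathsf{ReEx}$. - *OOO-NmLdRecCom*: if the commit slot is a $\mathsf{Done}$ $\mathsf{Nm}$, $\mathsf{Ld}$ or $\mathsf{Reconcile}$, remove it and update $rf$ with its result. - *OOO-StCom*: if the commit slot is a $\mathsf{Done}$ $\mathsf{St}$, remove it and append $\langle a,v,t,\mathrm{False}\rangle$ to $sb$. - *OOO-ComCom*: if the commit slot is $\mathsf{Commit}$ and $sb$ is empty, remove it. - *OOO-StReq*: for some address $a$ in $sb$ whose oldest store has $iss=$ False, call $\mathsf{reqSt}(a,v,t)$ for that store and set its $iss$ to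 True. Methods called by the memory: $\mathsf{respSt}(a)$ deletes the oldest store to $a$ from $sb$. $\mathsf{respLd}(idx,res,t)$: if $lf[idx]$, set $lf[idx]:=$ False; else, for the $\mathsf{Ld}$ entry at $idx$ (address $a$, current value $v$): if $ex=\mathsf{ReEx}$ set $ex:=\mathsf{Idle}$; otherwise record value $res$, tag $t$, $ex:=\mathsf{Done}$, and then if $v\ne\epsilon$ and $v\neq res$ do $\mathsf{flush}(idx+1,npc)$, else let $k=\mathsf{findStaleLd}(idx,a,t)$ and if $k\ne\top$ do $\mathsf{flush}(k,rob[k].pc)$. $\mathrm{OOO}^{VP}{+}\mathrm{CCM}$ is $n$ such processors connected to the $n$ ports of one CCM. **WMM.** State: monolithic memory $m$ (address to value) and for each processor $i$: register state (including PC), store buffer $sb_i$ (list of $\langle a,v\rangle$, oldest to youngest) and invalidation buffer $ib_i$ (list of $\langle a,v\rangle$ in insertion order). Instructions execute instantaneously in program order; executing one updates registers and PC. Rules for processor $i$, by next instruction: - $\mathsf{Nm}$: execute. - $\mathsf{Ld}\ a$, if $sb_i$ contains $a$: return the youngest value for $a$ in $sb_i$. - $\mathsf{Ld}\ a$, if $sb_i$ does not contain $a$: return $m[a]$ and remove all entries for $a$ from $ib_i$. - $\mathsf{Ld}\ a$, if $sb_i$ does not contain $a$ and $ib_i$ contains $a$: return the value of any entry for $a$ in $ib_i$ and remove all entries for $a$ inserted in $ib_i$ before that entry. - $\mathsf{St}\ a\ v$: append $\langle a,v\rangle$ to $sb_i$ and remove all entries for $a$ from $ib_i$. - $\mathsf{Commit}$: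 executes only if $sb_i$ is empty. - $\mathsf{Reconcile}$: execute and empty $ib_i$. - Background rule (dequeue): for some $a$ in $sb_i$, remove the oldest store $\langle a,v\rangle$ for $a$ from $sb_i$; let $old=m[a]$; set $m[a]:=v$; for every $j\ne i$ such that $sb_j$ does not contain $a$, insert $\langle a,old\rangle$ into $ib_j$. **Program behavior.** Consider any finite execution at whose end all store buffers are empty. Its behavior consists of: for each processor, the sequence of instructions committed from $rob$ (in WMM: executed), with their results ($\mathsf{Nm}$ values and next PCs, store addresses and data, load addresses and loaded values), and the final values in the monolithic memory. $A\subseteq B$ means that every behavior of $A$ is a behavior of $B$, for the same program and initial state. *)

(* Defs.v *)
(* Addresses, values, register names and program counters
   range over arbitrary eqTypes A, V, R and PC; processors are 'I_n. *)
From mathcomp Require Import all_boot.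

Set Implicit Arguments.
Unset Strict Implicit.
Unset Printing Implicit Defensive.

(* A step may be labelled with an observation; [exec s ls s'] collects the
   observations of a finite sequence of steps from s to s' in order. *)
Section Executions.
Context {S L : Type}.

Inductive exec (step : S -> option L -> S -> Prop) (s0 : S) :
    seq L -> S -> Prop :=
| ExecNil : exec step s0 [::] s0
| ExecStep ls s l s' :
    exec step s0 ls s -> step s l s' -> exec step s0 (ls ++ seq_of_opt l) s'.
End Executions.

Section Models.
Context {A V R PC : eqType} {n : nat}.

Record nm_instr := NmInstr
  { nm_op : PC -> seq V -> PC * V; nm_srcs : seq R; nm_dst : R }.
Record ld_instr := LdInstr
  { ld_addr : seq V -> A; ld_srcs : seq R; ld_dst : R }.
Record st_instr := StInstr
  { st_addr : seq V -> A; st_data : seq V -> V; st_srcs : seq R }.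

Inductive instr :=
| Nm of nm_instr | Ld of ld_instr | St of st_instr | Commit | Reconcile.

(* [seqpc] is the next PC of an instruction that is not an Nm. *)
Record program := Program { fetch : PC -> instr; seqpc : PC -> PC }.

Record init_state := InitState
  { init_pc : 'I_n -> PC; init_rf : 'I_n -> R -> V; init_mem : A -> V }.

(* A committed (in WMM: executed) instruction together with its results. *)
Inductive event :=
| ENm of nm_instr & PC & V
| ELd of ld_instr & A & V
| ESt of st_instr & A & V
| ECommit
| EReconcile.

Record behavior := Behavior
  { beh_trace : 'I_n -> seq event; beh_mem : A -> V }.

Definition proc_trace (ls : seq ('I_n * event)) (i : 'I_n) : seq event :=
  [seq x.2 | x <- ls & x.1 == i].

(* [inl a] is the tag of the initial value of address a; the store fetched by
   processor i into the reorder-buffer index k has tag [inr (i, k)], which is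
   globally unique since indices are never reused. *)
Definition st_tag : eqType := (A + 'I_n * nat)%type.

Inductive mem_req :=
| ReqLd of nat & A
| ReqSt of A & V & st_tag.

(* The request buffers [mrb i] are unordered: any element may be removed. *)
Record ccm := CCM { ccm_m : A -> V * st_tag; ccm_mrb : 'I_n -> seq mem_req }.

(* [None] encodes "not available" in the option-valued fields of rob entries. *)
Inductive rob_ins :=
| RNm of nm_instr & option V
| RLd of ld_instr & option A & option V & option st_tag
| RSt of st_instr & option A & option V & st_tag
| RCommit
| RReconcile.

Inductive ex_state := Idle | Exe | ReEx | Done.

Record rob_entry := Entry
  { e_pc : PC; e_npc : PC; e_ins : rob_ins; e_ex : ex_state }.

Record sb_entry := SbEntry
  { sb_a : A; sb_v : V; sb_t : st_tag; sb_iss : bool }.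

(* [rob] is the list of pairs (index, entry) from oldest to youngest; [nxt] is
   a strict upper bound of all the indices ever used. *)
Record proc := Proc
  { pcr : PC; rf : R -> V; rob : seq (nat * rob_entry); sb : seq sb_entry;
    lf : nat -> bool; nxt : nat }.

Definition set_rob ps r := Proc (pcr ps) (rf ps) r (sb ps) (lf ps) (nxt ps).
Definition set_rf ps f := Proc (pcr ps) f (rob ps) (sb ps) (lf ps) (nxt ps).
Definition set_sb ps b := Proc (pcr ps) (rf ps) (rob ps) b (lf ps) (nxt ps).
Definition set_lf ps l := Proc (pcr ps) (rf ps) (rob ps) (sb ps) l (nxt ps).

Definition rob_at (ps : proc) (idx : nat) : option rob_entry :=
  omap snd (ohead [seq p <- rob ps | p.1 == idx]).

Definition rob_upd (ps : proc) (idx : nat) (e : rob_entry) : proc :=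
  set_rob ps [seq if p.1 == idx then (idx, e) else p | p <- rob ps].

Definition older (ps : proc) (idx : nat) := [seq p <- rob ps | p.1 < idx].
Definition younger (ps : proc) (idx : nat) := [seq p <- rob ps | idx < p.1].

Definition ins_write (ins : rob_ins) : option (R * option V) :=
  match ins with
  | RNm x v => Some (nm_dst x, v)
  | RLd x _ v _ => Some (ld_dst x, v)
  | _ => None
  end.

(* Scanning from oldest to youngest, the last writer older than idx wins. *)
Definition src_val (ps : proc) (idx : nat) (r : R) : option V :=
  foldl (fun cur p => if ins_write (e_ins p.2) is Some (d, v)
                      then if d == r then v else cur else cur)
        (Some (rf ps r)) (older ps idx).

(* All the source registers are ready, with values vs. *)
Definition ready (ps : proc) (idx : nat) (srcs : seq R) (vs : seq V) : Prop :=
  [seq src_val ps idx r | r <- srcs] = [seq Some v | v <- vs].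

Definition ld_in_flight (e : rob_entry) : bool :=
  match e_ins e, e_ex e with
  | RLd _ _ _ _, (Exe | ReEx) => true
  | _, _ => false
  end.

Definition flush (ps : proc) (idx : nat) (pc : PC) : proc :=
  Proc pc (rf ps) (older ps idx) (sb ps)
       (fun k => lf ps k || has (fun p => [&& p.1 == k, idx <= p.1
                                            & ld_in_flight p.2]) (rob ps))
       (nxt ps).

Inductive bypass_res :=
| Hit of V & st_tag
| Blocked   (* epsilon: a Reconcile was met first *)
| NotFound. (* top *)

Definition bypass_sb (l : seq sb_entry) (a : A) : bypass_res :=
  if ohead [seq s <- l | sb_a s == a] is Some s
  then Hit (sb_v s) (sb_t s) else NotFound.

Fixpoint bypass_rob (l : seq (nat * rob_entry)) (a : A) (dflt : bypass_res) :
    bypass_res :=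
  if l is (_, e) :: l' then
    match e_ins e, e_ex e with
    | RReconcile, _ => Blocked
    | RSt _ (Some a') (Some v) t, Done =>
        if a' == a then Hit v t else bypass_rob l' a dflt
    | _, _ => bypass_rob l' a dflt
    end
  else dflt.

Definition findBypass (ps : proc) (idx : nat) (a : A) : bypass_res :=
  bypass_rob (rev (older ps idx)) a (bypass_sb (rev (sb ps)) a).

Fixpoint affected_in (l : seq (nat * rob_entry)) (a : A) : seq nat :=
  if l is (k, e) :: l' then
    match e_ins e, e_ex e with
    | RSt _ (Some a') _ _, _ =>
        if a' == a then [::] else affected_in l' a
    | RLd _ _ _ _, Idle => affected_in l' a
    | RLd _ (Some a') _ _, _ =>
        if a' == a then k :: affected_in l' a else affected_in l' a
    | _, _ => affected_in l' a
    end
  else [::].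

Definition findAffectedLd (ps : proc) (idx : nat) (a : A) : seq nat :=
  affected_in (younger ps idx) a.

Fixpoint stale_in (l : seq (nat * rob_entry)) (a : A) (t : st_tag) :
    option nat :=
  if l is (k, e) :: l' then
    match e_ins e, e_ex e with
    | RSt _ (Some a') _ _, _ => if a' == a then None else stale_in l' a t
    | RLd _ (Some a') _ (Some t'), Done =>
        if (a' == a) && (t' != t) then Some k else stale_in l' a t
    | _, _ => stale_in l' a t
    end
  else None.

Definition findStaleLd (ps : proc) (idx : nat) (a : A) (t : st_tag) :
    option nat :=
  stale_in (younger ps idx) a t.

Definition flush_at (ps : proc) (k : nat) : proc :=
  if rob_at ps k is Some e then flush ps k (e_pc e) else ps.

Fixpoint replay (ps : proc) (ks : seq nat) : proc :=
  if ks is k :: ks' then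
    match rob_at ps k with
    | Some (Entry pc npc ins Done) => flush ps k pc
    | Some (Entry pc npc ins _) =>
        replay (rob_upd ps k (Entry pc npc ins ReEx)) ks'
    | None => replay ps ks'
    end
  else ps.

(* A value prediction v (if any) for the load at idx is checked against res. *)
Definition mispredicted (v : option V) (res : V) : bool :=
  if v is Some v' then v' != res else false.

Definition rem_oldest {T : Type} (p : pred T) (s : seq T) : seq T :=
  take (find p s) s ++ drop (find p s).+1 s.

Definition respSt (ps : proc) (a : A) : proc :=
  set_sb ps (rem_oldest (fun s => sb_a s == a) (sb ps)).

(* The last branch is never taken: an outstanding request whose lf bit is
   False always belongs to a load still present in rob. *)
Definition respLd (ps : proc) (idx : nat) (res : V) (t : st_tag) : proc :=
  if lf ps idx then set_lf ps [eta lf ps with idx |-> false] else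
  match rob_at ps idx with
  | Some (Entry pc npc (RLd x a v t0) ReEx) =>
      rob_upd ps idx (Entry pc npc (RLd x a v t0) Idle)
  | Some (Entry pc npc (RLd x (Some a) v _) _) =>
      let ps' :=
        rob_upd ps idx (Entry pc npc (RLd x (Some a) (Some res) (Some t)) Done)
      in
      if mispredicted v res then flush ps' idx.+1 npc
      else if findStaleLd ps' idx a t is Some k then flush_at ps' k else ps'
  | _ => ps
  end.

Definition new_ins (ins : instr) (t : st_tag) : rob_ins :=
  match ins with
  | Nm x => RNm x None
  | Ld x => RLd x None None None
  | St x => RSt x None None t
  | Commit => RCommit
  | Reconcile => RReconcile
  end.

Definition new_ex (ins : instr) : ex_state :=
  match ins with Commit | Reconcile => Done | _ => Idle end.

Definition good_prediction (p : program) (pc npc : PC) : Prop :=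
  if fetch p pc is Nm _ then True else npc = seqpc p pc.

(* [ooo_rule p i ps l r ps']: processor i, running p, fires a rule from ps to
   ps', commits l (if any) and sends the request r (if any) to its port. *)
Inductive ooo_rule (p : program) (i : 'I_n) (ps : proc) :
    option event -> option mem_req -> proc -> Prop :=
| OOO_Fetch npc idx :
    good_prediction p (pcr ps) npc ->
    nxt ps <= idx ->
    ooo_rule p i ps None None
      (let ins := fetch p (pcr ps) in
       let e := Entry (pcr ps) npc (new_ins ins (inr (i, idx))) (new_ex ins) in
       Proc npc (rf ps) (rcons (rob ps) (idx, e)) (sb ps) (lf ps) idx.+1)
| OOO_NmEx idx pc npc x val0 vs nextpc val :
    rob_at ps idx = Some (Entry pc npc (RNm x val0) Idle) ->
    ready ps idx (nm_srcs x) vs ->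
    nm_op x pc vs = (nextpc, val) ->
    ooo_rule p i ps None None
      (let ps' := rob_upd ps idx (Entry pc nextpc (RNm x (Some val)) Done) in
       if nextpc != npc then flush ps' idx.+1 nextpc else ps')
| OOO_LdAddr idx pc npc x v t vs :
    rob_at ps idx = Some (Entry pc npc (RLd x None v t) Idle) ->
    ready ps idx (ld_srcs x) vs ->
    ooo_rule p i ps None None
      (rob_upd ps idx (Entry pc npc (RLd x (Some (ld_addr x vs)) v t) Idle))
| OOO_LdPred idx pc npc x a ex v :
    rob_at ps idx = Some (Entry pc npc (RLd x a None None) ex) ->
    ooo_rule p i ps None None
      (rob_upd ps idx (Entry pc npc (RLd x a (Some v) None) ex))
| OOO_LdBypass idx pc npc x a v vs res t :
    rob_at ps idx = Some (Entry pc npc (RLd x (Some a) v None) Idle) ->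
    ready ps idx (ld_srcs x) vs ->
    findBypass ps idx a = Hit res t ->
    ooo_rule p i ps None None
      (let ps' :=
         rob_upd ps idx (Entry pc npc (RLd x (Some a) (Some res) (Some t)) Done)
       in
       if mispredicted v res then flush ps' idx.+1 npc else ps')
| OOO_LdReq idx pc npc x a v vs :
    rob_at ps idx = Some (Entry pc npc (RLd x (Some a) v None) Idle) ->
    ready ps idx (ld_srcs x) vs ->
    findBypass ps idx a = NotFound ->
    ~~ lf ps idx ->
    ooo_rule p i ps None (Some (ReqLd idx a))
      (rob_upd ps idx (Entry pc npc (RLd x (Some a) v None) Exe))
| OOO_StEx idx pc npc x a0 v0 t vs :
    rob_at ps idx = Some (Entry pc npc (RSt x a0 v0 t) Idle) ->
    ready ps idx (st_srcs x) vs ->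
    ooo_rule p i ps None None
      (let a := st_addr x vs in
       let ins := RSt x (Some a) (Some (st_data x vs)) t in
       replay (rob_upd ps idx (Entry pc npc ins Done))
              (findAffectedLd ps idx a))
| OOO_NmCom idx pc npc x val rob' :
    rob ps = (idx, Entry pc npc (RNm x (Some val)) Done) :: rob' ->
    ooo_rule p i ps (Some (ENm x npc val)) None
      (set_rf (set_rob ps rob') [eta rf ps with nm_dst x |-> val])
| OOO_LdCom idx pc npc x a v t rob' :
    rob ps = (idx, Entry pc npc (RLd x (Some a) (Some v) t) Done) :: rob' ->
    ooo_rule p i ps (Some (ELd x a v)) None
      (set_rf (set_rob ps rob') [eta rf ps with ld_dst x |-> v])
| OOO_RecCom idx pc npc rob' :
    rob ps = (idx, Entry pc npc RReconcile Done) :: rob' ->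
    ooo_rule p i ps (Some EReconcile) None (set_rob ps rob')
| OOO_StCom idx pc npc x a v t rob' :
    rob ps = (idx, Entry pc npc (RSt x (Some a) (Some v) t) Done) :: rob' ->
    ooo_rule p i ps (Some (ESt x a v)) None
      (set_sb (set_rob ps rob') (rcons (sb ps) (SbEntry a v t false)))
| OOO_ComCom idx pc npc ex rob' :
    rob ps = (idx, Entry pc npc RCommit ex) :: rob' ->
    sb ps = [::] ->
    ooo_rule p i ps (Some ECommit) None (set_rob ps rob')
| OOO_StReq sb1 a v t sb2 :
    sb ps = sb1 ++ SbEntry a v t false :: sb2 ->
    a \notin [seq sb_a s | s <- sb1] ->
    ooo_rule p i ps None (Some (ReqSt a v t))
      (set_sb ps (sb1 ++ SbEntry a v t true :: sb2)).

Record ooo_ccm := OooCcm { oc_proc : 'I_n -> proc; oc_mem : ccm }.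

Definition send (c : ccm) (i : 'I_n) (r : option mem_req) : ccm :=
  CCM (ccm_m c)
      [eta ccm_mrb c with i |-> ccm_mrb c i ++ seq_of_opt r].

Inductive ooo_ccm_step (P : 'I_n -> program) (s : ooo_ccm) :
    option ('I_n * event) -> ooo_ccm -> Prop :=
| OC_Proc i l r ps' :
    ooo_rule (P i) i (oc_proc s i) l r ps' ->
    ooo_ccm_step P s (omap (pair i) l)
      (OooCcm [eta oc_proc s with i |-> ps'] (send (oc_mem s) i r))
| CCM_Ld i idx a b1 b2 v t :
    ccm_mrb (oc_mem s) i = b1 ++ ReqLd idx a :: b2 ->
    ccm_m (oc_mem s) a = (v, t) ->
    ooo_ccm_step P s None
      (OooCcm [eta oc_proc s with i |-> respLd (oc_proc s i) idx v t]
              (CCM (ccm_m (oc_mem s))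
                   [eta ccm_mrb (oc_mem s) with i |-> b1 ++ b2]))
| CCM_St i a v t b1 b2 :
    ccm_mrb (oc_mem s) i = b1 ++ ReqSt a v t :: b2 ->
    ooo_ccm_step P s None
      (OooCcm [eta oc_proc s with i |-> respSt (oc_proc s i) a]
              (CCM [eta ccm_m (oc_mem s) with a |-> (v, t)]
                   [eta ccm_mrb (oc_mem s) with i |-> b1 ++ b2])).

Definition ooo_ccm_init (I : init_state) : ooo_ccm :=
  OooCcm
    (fun i => Proc (init_pc I i) (init_rf I i) [::] [::] (fun _ => false) 0)
    (CCM (fun a => (init_mem I a, inl a)) (fun _ => [::])).

Definition ooo_ccm_behavior (P : 'I_n -> program) (I : init_state)
    (b : behavior) : Prop :=
  exists (ls : seq ('I_n * event)) (s : ooo_ccm),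
    [/\ exec (ooo_ccm_step P) (ooo_ccm_init I) ls s,
        forall i, sb (oc_proc s i) = [::],
        forall i, beh_trace b i = proc_trace ls i
      & forall a, beh_mem b a = (ccm_m (oc_mem s) a).1].

Record wmm_proc := WmmProc
  { w_pc : PC; w_rf : R -> V; w_sb : seq (A * V); w_ib : seq (A * V) }.

Record wmm := Wmm { w_proc : 'I_n -> wmm_proc; w_m : A -> V }.

Definition without (a : A) (b : seq (A * V)) : seq (A * V) :=
  [seq x <- b | x.1 != a].

Definition has_addr (a : A) (b : seq (A * V)) : bool :=
  a \in [seq x.1 | x <- b].

(* Instruction execution by one processor, with monolithic memory m. *)
Inductive wmm_exec (p : program) (m : A -> V) (w : wmm_proc) :
    event -> wmm_proc -> Prop :=
| WMM_Nm x nextpc val :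
    fetch p (w_pc w) = Nm x ->
    nm_op x (w_pc w) [seq w_rf w r | r <- nm_srcs x] = (nextpc, val) ->
    wmm_exec p m w (ENm x nextpc val)
      (WmmProc nextpc [eta w_rf w with nm_dst x |-> val] (w_sb w) (w_ib w))
| WMM_LdSb x a v sb1 sb2 :
    fetch p (w_pc w) = Ld x ->
    a = ld_addr x [seq w_rf w r | r <- ld_srcs x] ->
    w_sb w = sb1 ++ (a, v) :: sb2 ->
    ~~ has_addr a sb2 ->
    wmm_exec p m w (ELd x a v)
      (WmmProc (seqpc p (w_pc w)) [eta w_rf w with ld_dst x |-> v]
               (w_sb w) (w_ib w))
| WMM_LdMem x a :
    fetch p (w_pc w) = Ld x ->
    a = ld_addr x [seq w_rf w r | r <- ld_srcs x] ->
    ~~ has_addr a (w_sb w) ->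
    wmm_exec p m w (ELd x a (m a))
      (WmmProc (seqpc p (w_pc w)) [eta w_rf w with ld_dst x |-> m a]
               (w_sb w) (without a (w_ib w)))
| WMM_LdIb x a v ib1 ib2 :
    fetch p (w_pc w) = Ld x ->
    a = ld_addr x [seq w_rf w r | r <- ld_srcs x] ->
    ~~ has_addr a (w_sb w) ->
    w_ib w = ib1 ++ (a, v) :: ib2 ->
    wmm_exec p m w (ELd x a v)
      (WmmProc (seqpc p (w_pc w)) [eta w_rf w with ld_dst x |-> v]
               (w_sb w) (without a ib1 ++ (a, v) :: ib2))
| WMM_St x a v :
    fetch p (w_pc w) = St x ->
    a = st_addr x [seq w_rf w r | r <- st_srcs x] ->
    v = st_data x [seq w_rf w r | r <- st_srcs x] ->
    wmm_exec p m w (ESt x a v)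
      (WmmProc (seqpc p (w_pc w)) (w_rf w)
               (rcons (w_sb w) (a, v)) (without a (w_ib w)))
| WMM_Com :
    fetch p (w_pc w) = Commit ->
    w_sb w = [::] ->
    wmm_exec p m w ECommit
      (WmmProc (seqpc p (w_pc w)) (w_rf w) (w_sb w) (w_ib w))
| WMM_Rec :
    fetch p (w_pc w) = Reconcile ->
    wmm_exec p m w EReconcile
      (WmmProc (seqpc p (w_pc w)) (w_rf w) (w_sb w) [::]).

Definition invalidate (a : A) (old : V) (w : wmm_proc) : wmm_proc :=
  if has_addr a (w_sb w) then w
  else WmmProc (w_pc w) (w_rf w) (w_sb w) (rcons (w_ib w) (a, old)).

Inductive wmm_step (P : 'I_n -> program) (s : wmm) :
    option ('I_n * event) -> wmm -> Prop :=
| WMM_Exec i e w' :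
    wmm_exec (P i) (w_m s) (w_proc s i) e w' ->
    wmm_step P s (Some (i, e)) (Wmm [eta w_proc s with i |-> w'] (w_m s))
| WMM_DeqSb i a v sb1 sb2 :
    w_sb (w_proc s i) = sb1 ++ (a, v) :: sb2 ->
    ~~ has_addr a sb1 ->
    wmm_step P s None
      (Wmm (fun j => let w := w_proc s j in
                     if j == i
                     then WmmProc (w_pc w) (w_rf w) (sb1 ++ sb2) (w_ib w)
                     else invalidate a (w_m s a) w)
           [eta w_m s with a |-> v]).

Definition wmm_init (I : init_state) : wmm :=
  Wmm (fun i => WmmProc (init_pc I i) (init_rf I i) [::] [::]) (init_mem I).

Definition wmm_behavior (P : 'I_n -> program) (I : init_state)
    (b : behavior) : Prop :=
  exists (ls : seq ('I_n * event)) (s : wmm),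
    [/\ exec (wmm_step P) (wmm_init I) ls s,
        forall i, w_sb (w_proc s i) = [::],
        forall i, beh_trace b i = proc_trace ls i
      & forall a, beh_mem b a = w_m s a].

End Models.

Arguments nm_instr : clear implicits.
Arguments ld_instr : clear implicits.
Arguments st_instr : clear implicits.
Arguments instr : clear implicits.
Arguments program : clear implicits.
Arguments event : clear implicits.
Arguments init_state : clear implicits.
Arguments behavior : clear implicits.

(* Main.v *)
(* Forward simulation: WMM executes an instruction when OOO commits it from the
   reorder buffer, and dequeues a store when CCM writes it to memory, so both
   models produce the same trace.  The pending loads are what makes this work.
   A load which has its value agrees with findBypass whenever findBypass finds
   a store; otherwise the value is that of the memory or of an overwritten store
   still in the invalidation buffer.  For each address, the values of the loads
   of the second kind occur, in program order, as a subsequence with repetitions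
   of the invalidation buffer followed by the memory value.  So each of them is
   still available when the load commits, although WMM discards what is older.
   findStaleLd, findAffectedLd and the blocking by Reconcile maintain this. *)
Require Import Defs.
From mathcomp Require Import all_boot.
(* Defs.NotFound is shadowed by a constructor of all_boot. *)
Import Defs.

Set Implicit Arguments.
Unset Strict Implicit.
Unset Printing Implicit Defensive.

(** * Subsequences with repetitions *)

(** The obstacle is that loads complete out of program order. A response to an older load puts a
    value into the middle of the sequence of pending memory loads. As this is the newest value of
    its address, every younger memory load that is kept must have the same one. The hardware can
    only compare tags, so histories consist of value-tag pairs and a ghost map turns equal tags into
    equal values. Two closure properties absorb most steps: a flush keeps a prefix of the pending
    loads, and a write by another processor extends the history on the right. A load in state [Exe]
    still sees [NotFound]: an older store to its address that executes meanwhile marks it [ReEx] or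
    flushes it. Hence its response may count as a memory value, whereas that of a [ReEx] load is
    thrown away. Speculation on registers and PCs is covered by a chain through the reorder buffer:
    each entry continues the PC of the preceding one and has computed from the source values that it
    sees. Missing values may appear, but any correction cuts the chain. A predicted load value is
    unconstrained until the load is [Done], since it is checked then. *)

Section Fits.
Context {T : Type}.

(** [FitsHere] leaves [x] in the history since several loads may read the same value; [FitsSkip]
    drops it for good, as WMM does with the invalidation entries older than the one it reads. *)
Inductive fits : seq T -> seq T -> Prop :=
| FitsNil h : fits [::] h
| FitsHere x s h : fits s (x :: h) -> fits (x :: s) (x :: h)
| FitsSkip x s h : fits s h -> fits s (x :: h).

Lemma fits_catr s h h' : fits s h -> fits s (h ++ h').
Proof.
by elim=> [?|x {}s {}h _ IH|x {}s {}h _ IH] /=; constructor.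
Qed.

Lemma fits_catl s s' h : fits (s ++ s') h -> fits s h.
Proof.
move E: (s ++ s') => u F; elim: F s E => {u h} [h|x u h _ IH|x u h _ IH] s.
- by case: s => // _; constructor.
- by case: s => [_|y s [-> /IH]]; constructor.
- by move/IH; constructor 3.
Qed.

(** Serves the commit of the oldest load: what lies before [x] may be discarded, and the other loads
    still fit from [x] on. *)
Lemma fits_cons_inv x s h :
  fits (x :: s) h -> exists h1 h2, h = h1 ++ x :: h2 /\ fits s (x :: h2).
Proof.
move E: (x :: s) => u F; elim: F E => {u h} [//|y u h F _ [-> ->]|y u h _ IH E].
  by exists [::], h.
by have [h1 [h2 [-> F]]] := IH E; exists (y :: h1), h2.
Qed.

(** Nothing follows the last element of the history, so whatever has been matched before, any number
    of copies of it may come next. This is how loads get the current memory value. *)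
Lemma fits_rcons s h x m :
  fits s (rcons h x) -> fits (s ++ nseq m x) (rcons h x).
Proof.
have fits_nseq k : fits (nseq m x) (rcons k x).
  elim: k => [|y k IH] /=; last by constructor 3.
  by elim: m => [|m' IH] /=; constructor.
move E: (rcons h x) => u F; elim: F h E => {s u} [u|y s u _ IH|y s u F IH] h E.
- by rewrite -E; apply: fits_nseq.
- by constructor; apply: (IH h).
- case: h E => [[E1 E2]|z h [E1 E2]]; last by constructor 3; apply: (IH h).
  by case: F E2 => // k <-; rewrite -E1; apply: (fits_nseq [::]).
Qed.

End Fits.

(** * Views of the reorder buffer *)

Section Simulation.
Context {A V R PC : eqType} {n : nat}.
Local Notation tag := (@st_tag A n).
Local Notation entry := (@rob_entry A V R PC n).
Local Notation byres := (@bypass_res A V n).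
Local Notation proc := (@proc A V R PC n).
Local Notation sbe := (@sb_entry A V n).
Local Notation wproc := (@wmm_proc A V R PC).
Local Notation mreq := (@mem_req A V n).
Implicit Types (rv : R -> option V) (fw : A -> byres) (e : entry)
  (l : seq (nat * entry)) (ps : proc) (G : tag -> option V).

(* The oldest-to-youngest counterparts of src_val and findBypass: what the entry
   after e sees, given the register values rv and the bypass results fw which
   e sees. *)
Definition rv_step rv e : R -> option V := fun r =>
  if ins_write (e_ins e) is Some (d, v) then if d == r then v else rv r
  else rv r.

Definition fw_step fw e : A -> byres := fun a =>
  bypass_rob [:: (0, e)] a (fw a).

Definition rv_after rv l := foldl (fun f p => rv_step f p.2) rv l.
Definition fw_after fw l := foldl (fun f p => fw_step f p.2) fw l.

(* The ghost map G gives the value of every executed store.  It is only ever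
   extended, so equal tags imply equal values, which findStaleLd relies on. *)
Definition entry_ok (p : program A V R PC) (i : 'I_n) G rv fw (k : nat) e :
    Prop :=
  match e_ins e, e_ex e with
  | RNm x val, Idle => fetch p (e_pc e) = Nm x /\ val = None
  | RNm x val, Done => fetch p (e_pc e) = Nm x /\ exists vs v,
      [/\ [seq rv r | r <- nm_srcs x] = [seq Some v | v <- vs], val = Some v
        & nm_op x (e_pc e) vs = (e_npc e, v)]
  | RNm _ _, _ => False
  | RLd x oa ov ot, ex =>
      [/\ fetch p (e_pc e) = Ld x, e_npc e = seqpc p (e_pc e),
          forall a, oa = Some a -> exists2 vs,
            [seq rv r | r <- ld_srcs x] = [seq Some v | v <- vs]
            & a = ld_addr x vs
        & match ex with
          | Idle => ot = None
          | Exe => ot = None /\ exists2 a, oa = Some a & fw a = NotFound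
          | ReEx => ot = None /\ exists a, oa = Some a
          | Done => exists a v t, [/\ oa = Some a, ov = Some v, ot = Some t,
              G t = Some v & fw a = Hit v t \/ fw a = NotFound]
          end]
  | RSt x oa ov t, ex =>
      [/\ fetch p (e_pc e) = St x, e_npc e = seqpc p (e_pc e), t = inr (i, k)
        & match ex with
          | Idle => oa = None /\ G t = None
          | Done => exists2 vs,
              [seq rv r | r <- st_srcs x] = [seq Some v | v <- vs]
              & [/\ oa = Some (st_addr x vs), ov = Some (st_data x vs)
                  & G t = Some (st_data x vs)]
          | _ => False
          end]
  | RCommit, _ => fetch p (e_pc e) = Commit /\ e_npc e = seqpc p (e_pc e)
  | RReconcile, _ =>
      fetch p (e_pc e) = Reconcile /\ e_npc e = seqpc p (e_pc e)
  end.

(** Threading the views from oldest to youngest makes the structural changes local: a commit drops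
    the head and advances [c], [rv] and [fw] to the new architectural state, a fetch appends at [f],
    and a flush keeps a prefix and replaces [f]. *)
Fixpoint rob_ok (p : program A V R PC) (i : 'I_n) G (c : PC) rv fw l (f : PC) :
    Prop :=
  if l is (k, e) :: l' then
    [/\ e_pc e = c, entry_ok p i G rv fw k e
      & rob_ok p i G (e_npc e) (rv_step rv e) (fw_step fw e) l' f]
  else c = f.

(** An available value must not change, because younger entries may have computed from it. *)
Definition rv_le rv rv' := forall r v, rv r = Some v -> rv' r = Some v.
(* The changes of bypass results that entry_ok tolerates: they become Blocked no
   more when a Reconcile commits, and NotFound when a store reaches memory. *)
Definition fw_le fw fw' :=
  forall a, [\/ fw a = fw' a, fw a = Blocked | fw' a = NotFound].

Lemma fw_step_rec fw e a :
  fw_step fw e a = match e_ins e, e_ex e with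
    | RReconcile, _ => Blocked
    | RSt _ (Some a') (Some v) t, Done => if a' == a then Hit v t else fw a
    | _, _ => fw a
    end.
Proof. by []. Qed.

Lemma rv_le_step rv rv' e :
  rv_le rv rv' -> rv_le (rv_step rv e) (rv_step rv' e).
Proof.
move=> le r v; rewrite /rv_step.
by case: (ins_write _) => [[d u]|]; [case: eqP => // _ |]; apply: le.
Qed.

(** An entry either decides the search for [a] whatever lies before it, or is transparent. Views
    that agree or are comparable therefore stay so across an entry. *)
Lemma fw_step_cases e a :
  (exists2 b, b <> NotFound & forall fw, fw_step fw e a = b) \/
  (forall fw, fw_step fw e a = fw a).
Proof.
case: e => pc npc [x v|x oa ov ot|x [a'|] [v|] t||] ex; try by right.
- case: ex; try by right.
  case E: (a' == a); [left; exists (Hit v t) => // fw | right => fw];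
    by rewrite fw_step_rec /= E.
- by left; exists Blocked.
Qed.

Lemma fw_le_step fw fw' e :
  fw_le fw fw' -> fw_le (fw_step fw e) (fw_step fw' e).
Proof.
move=> le a; case: (fw_step_cases e a) => [[b _ H]|H]; rewrite !H //.
by constructor 1.
Qed.

Lemma map_rv_le (rs : seq R) vs rv rv' : rv_le rv rv' ->
  [seq rv r | r <- rs] = [seq Some v | v <- vs] ->
  [seq rv' r | r <- rs] = [seq Some v | v <- vs].
Proof.
move=> le; elim: rs vs => [|r rs IH] [|v vs] //= [/le -> /IH ->] //.
Qed.

(** No executed or in-flight load relies on [Blocked], and each of them accepts [NotFound] in place
    of a hit, which is exactly the freedom in [fw_le]. The second hypothesis keeps the tag of a
    store that is still [Idle] free. *)
Lemma entry_ok_mono p i G G' rv rv' fw fw' k e :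
  (forall t v, G t = Some v -> G' t = Some v) ->
  (G (inr (i, k)) = None -> G' (inr (i, k)) = None) ->
  rv_le rv rv' -> fw_le fw fw' -> entry_ok p i G rv fw k e ->
  entry_ok p i G' rv' fw' k e.
Proof.
move=> leG newG leR leF; rewrite /entry_ok.
case: (e_ins e) => // [x val|x oa ov ot|x oa ov t].
- case: (e_ex e) => // -[-> [vs [v [/(map_rv_le leR) H -> E]]]].
  by split=> //; exists vs, v.
- case=> -> -> H1 H2; split=> //.
    by move=> a /H1 [vs /(map_rv_le leR) H ->]; exists vs.
  case: (e_ex e) H2 => //.
    case=> -> [a -> Fa]; split=> //; exists a => //.
    by case: (leF a) => [<-|E|->] //; rewrite E in Fa.
  case=> a [v [t [-> -> -> /leG Gt H]]]; exists a, v, t; split=> //.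
  by case: (leF a) => [<-|E|->] //; [rewrite E in H; case: H | right].
- case=> -> -> -> H; split=> //; case: (e_ex e) H => //.
    by case=> -> /newG ->.
  by case=> vs /(map_rv_le leR) H [-> -> /leG ->]; exists vs.
Qed.

Lemma rob_ok_mono p i G G' c rv rv' fw fw' l f :
  (forall t v, G t = Some v -> G' t = Some v) ->
  (forall k, k \in unzip1 l -> G (inr (i, k)) = None ->
    G' (inr (i, k)) = None) ->
  rv_le rv rv' -> fw_le fw fw' -> rob_ok p i G c rv fw l f ->
  rob_ok p i G' c rv' fw' l f.
Proof.
move=> leG.
elim: l c rv rv' fw fw' => [//|[k e] l IH] c rv rv' fw fw' newG leR leF /=.
case=> -> ok1 ok2; split=> //.
  by apply: entry_ok_mono ok1 => //; apply: newG; rewrite inE eqxx.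
apply: IH ok2; [|exact: rv_le_step|exact: fw_le_step].
by move=> j Hj; apply: newG; rewrite inE Hj orbT.
Qed.

Lemma rob_ok_le p i G c rv rv' fw fw' l f :
  rv_le rv rv' -> fw_le fw fw' -> rob_ok p i G c rv fw l f ->
  rob_ok p i G c rv' fw' l f.
Proof. exact: rob_ok_mono. Qed.

Lemma rob_ok_cat p i G c rv fw l1 l2 f :
  rob_ok p i G c rv fw (l1 ++ l2) f <->
  exists2 c', rob_ok p i G c rv fw l1 c'
    & rob_ok p i G c' (rv_after rv l1) (fw_after fw l1) l2 f.
Proof.
elim: l1 c rv fw => [|[k e] l1 IH] c rv fw /=.
  by split=> [H|[c' -> //]]; exists c.
split=> [[-> ok1 /IH [c' ok2 ok3]]|[c' [-> ok1 ok2] ok3]].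
  by exists c'.
by split=> //; apply/IH; exists c'.
Qed.

Lemma rob_ok_split p i G c rv fw l1 k e l2 f :
  rob_ok p i G c rv fw (l1 ++ (k, e) :: l2) f <->
  [/\ rob_ok p i G c rv fw l1 (e_pc e),
      entry_ok p i G (rv_after rv l1) (fw_after fw l1) k e
    & rob_ok p i G (e_npc e) (rv_step (rv_after rv l1) e)
        (fw_step (fw_after fw l1) e) l2 f].
Proof.
split=> [/rob_ok_cat [c' H [E ok1 ok2]]|[H ok1 ok2]]; first by rewrite E.
by apply/rob_ok_cat; exists (e_pc e).
Qed.

Lemma rv_afterE rv l r :
  rv_after rv l r = foldl (fun cur p => if ins_write (e_ins p.2) is Some (d, v)
                      then if d == r then v else cur else cur) (rv r) l.
Proof. by elim: l rv => //= p l IH rv; rewrite IH. Qed.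

Lemma bypass_rob_cat l1 l2 a (d : byres) :
  bypass_rob (l1 ++ l2) a d = bypass_rob l1 a (bypass_rob l2 a d).
Proof.
elim: l1 => //= -[k e] l1 ->.
by case: (e_ins e) => // x [b|] // [v|] // t; case: (e_ex e).
Qed.

Lemma fw_afterE fw l a : fw_after fw l a = bypass_rob (rev l) a (fw a).
Proof.
elim: l fw => //= -[k e] l IH fw; rewrite IH rev_cons -cats1 bypass_rob_cat.
by [].
Qed.

(** Running the entry on [NotFound] tests whether it decides the search itself, that is, whether it
    is a Reconcile or an executed store to [a]. *)
Definition stops a e : bool :=
  if fw_step (fun _ => NotFound) e a is NotFound then false else true.

Definition done_ld a e : seq (V * tag) :=
  match e_ins e, e_ex e with
  | RLd _ (Some a') (Some v) (Some t), Done =>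
      if a' == a then [:: (v, t)] else [::]
  | _, _ => [::]
  end.

(* The loads of a which got their value from the memory, provided that the store
   buffer has no store to a. *)
Fixpoint mem_lds a l : seq (V * tag) :=
  if l is (_, e) :: l' then
    if stops a e then [::] else done_ld a e ++ mem_lds a l'
  else [::].

Lemma fw_step_stop fw e a : stops a e -> fw_step fw e a <> NotFound.
Proof.
rewrite /stops; case: (fw_step_cases e a) => [[b Hb H]|H]; rewrite !H //.
Qed.

Lemma fw_step_go fw e a : ~~ stops a e -> fw_step fw e a = fw a.
Proof.
rewrite /stops; case: (fw_step_cases e a) => [[b Hb H]|H]; rewrite !H //.
by case: b Hb {H} => // /(_ erefl).
Qed.

Lemma fw_after_cases fw l a :
  if has (fun p => stops a p.2) l then fw_after fw l a <> NotFound
  else fw_after fw l a = fw a.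
Proof.
elim: l fw => //= -[k e] l IH fw /=; move: (IH (fw_step fw e)).
case: ifP => _ H; first by rewrite orbT.
rewrite orbF H; case: ifP => [/fw_step_stop //|/negbT/fw_step_go //]; exact.
Qed.

Lemma mem_lds_cat a l1 l2 :
  mem_lds a (l1 ++ l2) =
  mem_lds a l1 ++
  (if has (fun p => stops a p.2) l1 then [::] else mem_lds a l2).
Proof.
elim: l1 => //= -[k e] l1 IH /=; case: (stops a e) => //=.
by rewrite IH catA.
Qed.

Lemma mem_lds_upd a l1 k e e' l2 :
  has (fun p => stops a p.2) l1 \/
  stops a e = stops a e' /\ done_ld a e = done_ld a e' ->
  mem_lds a (l1 ++ (k, e') :: l2) = mem_lds a (l1 ++ (k, e) :: l2).
Proof. by rewrite !mem_lds_cat; case=> [->|[/= -> ->]]. Qed.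

(** No entry before a collected load decides the search for [a], so the load sees the same bypass
    result as the head of the list. According to that result, the collected loads all equal a
    buffered store, come from memory, or do not exist. *)
Lemma mem_lds_ok p i G c rv fw l f a x :
  rob_ok p i G c rv fw l f -> x \in mem_lds a l ->
  G x.2 = Some x.1 /\ (fw a = Hit x.1 x.2 \/ fw a = NotFound).
Proof.
elim: l c rv fw => //= -[k e] l IH c rv fw [_ ok1 ok2].
case S: (stops a e) => //; rewrite mem_cat => /orP[|Hx]; last first.
  by have := IH _ _ _ ok2 Hx; rewrite fw_step_go ?S.
move: ok1; rewrite /entry_ok /done_ld.
case: (e_ins e) => // y [a'|] // [v|] // [t|] //; case: (e_ex e) => //.
case: eqP => // -> [_ _ _ [b [v' [t' [[<-] [<-] [<-] Gt F]]]]].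
by rewrite inE => /eqP ->.
Qed.

(** * Addressing an entry by its index *)

Definition incr l := pairwise ltn (unzip1 l).

Lemma incr_split l1 k e l2 : incr (l1 ++ (k, e) :: l2) ->
  [/\ incr l1, all (fun p => p.1 < k) l1, all (fun p => k < p.1) l2
    & incr l2].
Proof.
rewrite /incr /unzip1 map_cat pairwise_cat /= => /and3P [H1 -> /andP [H2 ->]].
move: H1 H2; rewrite allrel_consr !all_map => /andP [H1 _] H2; split=> //.
Qed.

Lemma incr_upd l1 k e e' l2 : incr (l1 ++ (k, e) :: l2) ->
  incr (l1 ++ (k, e') :: l2).
Proof. by rewrite /incr /unzip1 !map_cat. Qed.

Lemma incr_catl l1 l2 : incr (l1 ++ l2) -> incr l1.
Proof. by rewrite /incr /unzip1 map_cat pairwise_cat => /and3P []. Qed.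

Lemma incr_catr l1 l2 : incr (l1 ++ l2) -> incr l2.
Proof. by rewrite /incr /unzip1 map_cat pairwise_cat => /and3P []. Qed.

Lemma filter_none {T} (a b : pred T) s :
  (forall x, b x -> ~~ a x) -> all b s -> filter a s = [::].
Proof.
by move=> H; elim: s => //= x s IH /andP [/H /negPf -> /IH].
Qed.

Lemma map_if_id {T} (a b : pred T) (f : T -> T) s :
  (forall x, b x -> ~~ a x) -> all b s ->
  [seq if a x then f x else x | x <- s] = s.
Proof.
by move=> H; elim: s => //= x s IH /andP [/H /negPf -> /IH ->].
Qed.

Lemma rob_at_mid ps l1 k e l2 : rob ps = l1 ++ (k, e) :: l2 ->
  incr (rob ps) -> rob_at ps k = Some e.
Proof.
move=> E; rewrite E => /incr_split [_ H _ _].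
rewrite /rob_at E filter_cat /= eqxx (filter_none _ H) // => p Hp.
by rewrite ltn_eqF.
Qed.

Lemma older_mid ps l1 k e l2 : rob ps = l1 ++ (k, e) :: l2 ->
  incr (rob ps) -> older ps k = l1.
Proof.
move=> E; rewrite E => /incr_split [_ H1 H2 _].
rewrite /older E filter_cat /= ltnn (all_filterP H1).
rewrite (filter_none _ H2) ?cats0 //.
by move=> p Hp; rewrite -leqNgt ltnW.
Qed.

Lemma olderS_mid ps l1 k e l2 : rob ps = l1 ++ (k, e) :: l2 ->
  incr (rob ps) -> older ps k.+1 = rcons l1 (k, e).
Proof.
move=> E; rewrite E => /incr_split [_ H1 H2 _].
rewrite /older E filter_cat /= ltnS leqnn (filter_none _ H2) ?cats1.
  by rewrite (all_filterP (sub_all _ H1)) // => p /= /ltnW.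
by move=> p Hp; rewrite ltnS -ltnNge.
Qed.

Lemma younger_mid ps l1 k e l2 : rob ps = l1 ++ (k, e) :: l2 ->
  incr (rob ps) -> younger ps k = l2.
Proof.
move=> E; rewrite E => /incr_split [_ H1 H2 _].
rewrite /younger E filter_cat /= ltnn (all_filterP H2) (filter_none _ H1) //.
by move=> p Hp; rewrite -leqNgt ltnW.
Qed.

Lemma rob_upd_mid ps l1 k e l2 e' : rob ps = l1 ++ (k, e) :: l2 ->
  incr (rob ps) -> rob_upd ps k e' = set_rob ps (l1 ++ (k, e') :: l2).
Proof.
move=> E; rewrite E => /incr_split [_ H1 H2 _].
rewrite /rob_upd E map_cat /= eqxx (map_if_id _ _ H1) ?(map_if_id _ _ H2) //.
- by move=> p Hp; rewrite gtn_eqF.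
- by move=> p Hp; rewrite ltn_eqF.
Qed.

Lemma rob_atP ps k e : rob_at ps k = Some e -> incr (rob ps) ->
  exists l1 l2, rob ps = l1 ++ (k, e) :: l2.
Proof.
rewrite /rob_at => H _; elim: (rob ps) H => //= -[j e'] l IH /=.
case: eqP => [-> [->]|_ /IH [l1 [l2 ->]]]; first by exists [::], l.
by exists ((j, e') :: l1), l2.
Qed.

Definition sb_view (b : seq sbe) : A -> byres := bypass_sb (rev b).

Lemma src_val_mid ps l1 k e l2 r : rob ps = l1 ++ (k, e) :: l2 ->
  incr (rob ps) -> src_val ps k r = rv_after (Some \o rf ps) l1 r.
Proof. by move=> E I; rewrite /src_val (older_mid E I) rv_afterE. Qed.

Lemma ready_mid ps l1 k e l2 rs vs : rob ps = l1 ++ (k, e) :: l2 ->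
  incr (rob ps) -> ready ps k rs vs ->
  [seq rv_after (Some \o rf ps) l1 r | r <- rs] = [seq Some v | v <- vs].
Proof.
move=> E I <-; apply: eq_map => r; by rewrite (src_val_mid r E I).
Qed.

Lemma findBypass_mid ps l1 k e l2 a : rob ps = l1 ++ (k, e) :: l2 ->
  incr (rob ps) -> findBypass ps k a = fw_after (sb_view (sb ps)) l1 a.
Proof. by move=> E I; rewrite /findBypass (older_mid E I) fw_afterE. Qed.

Lemma bypass_sb_cat (b1 b2 : seq sbe) a :
  bypass_sb (b1 ++ b2) a =
  if bypass_sb b1 a is Hit v t then Hit v t else bypass_sb b2 a.
Proof.
by rewrite /bypass_sb filter_cat; case: [seq s <- b1 | _].
Qed.

Lemma sb_view_cat (b1 b2 : seq sbe) a :
  sb_view (b1 ++ b2) a =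
  if sb_view b2 a is Hit v t then Hit v t else sb_view b1 a.
Proof. by rewrite /sb_view rev_cat bypass_sb_cat. Qed.

Lemma sb_view1 (s : sbe) a :
  sb_view [:: s] a = if sb_a s == a then Hit (sb_v s) (sb_t s) else NotFound.
Proof. by rewrite /sb_view /bypass_sb /=; case: eqP. Qed.

Lemma sb_view_cases (b : seq sbe) a :
  match sb_view b a with
  | Hit v t => exists b1 s b2, [/\ b = b1 ++ s :: b2, sb_a s = a, sb_v s = v,
      sb_t s = t & a \notin [seq sb_a s | s <- b2]]
  | Blocked => False
  | NotFound => a \notin [seq sb_a s | s <- b]
  end.
Proof.
elim/last_ind: b => [//|b s IH]; rewrite -cats1 sb_view_cat sb_view1.
case: eqP => [Ea|/eqP Na]; first by exists b, s, [::].
move: IH; case: (sb_view b a) => [v t [b1 [s' [b2 [-> E1 E2 E3 Hb]]]]|//|Hb].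
  exists b1, s', (rcons b2 s); rewrite cats1 -rcons_cons rcons_cat; split=> //.
  by rewrite map_rcons mem_rcons inE negb_or Hb eq_sym Na.
by rewrite map_cat mem_cat /= inE negb_or Hb eq_sym Na.
Qed.

Lemma sb_view_NotFound (b : seq sbe) a :
  a \notin [seq sb_a s | s <- b] <-> sb_view b a = NotFound.
Proof.
have := sb_view_cases b a; case E: (sb_view b a) => [v t|//|//].
case=> [b1 [s [b2 [-> <- _ _ _]]]]; split=> //.
by rewrite map_cat mem_cat /= inE eqxx orbT.
Qed.

(** * Outstanding memory requests *)

Definition ld_req (r : mreq) : option (nat * A) :=
  if r is ReqLd k a then Some (k, a) else None.
Definition st_req (r : mreq) : option (A * (V * tag)) :=
  if r is ReqSt a v t then Some (a, (v, t)) else None.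

Definition in_flight_at a e : bool :=
  match e_ins e, e_ex e with
  | RLd _ (Some a') _ _, (Exe | ReEx) => a' == a
  | _, _ => false
  end.

(** Accounts for an outstanding [ReqLd k a]: either its load was flushed and the response will be
    swallowed by [lf], or the load is still waiting, with this very address. *)
Definition pending ps k a : bool :=
  lf ps k || has (fun p => (p.1 == k) && in_flight_at a p.2) (rob ps).

Lemma in_flight_at_ld a e : in_flight_at a e -> ld_in_flight e.
Proof.
rewrite /in_flight_at /ld_in_flight.
by case: (e_ins e) => // x [b|] // v t; case: (e_ex e).
Qed.

Lemma pending_flush ps j pc k a : pending ps k a -> pending (flush ps j pc) k a.
Proof.
rewrite /pending /= => /orP [-> //|]; rewrite /older.
elim: (rob ps) => [|p l IH] /=.
  by rewrite orbF.
case/orP => [/andP [/eqP Ek H]|/IH].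
  rewrite Ek eqxx (in_flight_at_ld H) andbT.
  by case: leqP => /=; rewrite ?orbT // Ek eqxx H !orbT.
case/orP; first by case/orP => ->; rewrite ?orbT.
by case: ifP => /= _ ->; rewrite !orbT.
Qed.

Lemma pending_upd ps l1 j e e' l2 k a :
  rob ps = l1 ++ (j, e) :: l2 ->
  (k = j -> in_flight_at a e -> in_flight_at a e') ->
  pending ps k a -> pending (set_rob ps (l1 ++ (j, e') :: l2)) k a.
Proof.
rewrite /pending => -> H /=; rewrite !has_cat /=.
by case/or4P => [->|->|/andP [/eqP E /(H (esym E)) ->]|->];
  rewrite ?E ?eqxx ?orbT.
Qed.

(* The values of a which a WMM load may return, from oldest to youngest; the
   invalidation buffer is decorated with tags. *)
Definition history a (ib : seq (A * (V * tag))) (x : V * tag) : seq (V * tag) :=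
  rcons [seq y.2 | y <- ib & y.1 == a] x.

(** [pi_fits] is limited to addresses absent from the store buffer: for the others WMM reads the
    store buffer and receives no invalidations. [pi_st] ties each store request to the oldest
    buffered store to its address, the one that [respSt] removes. *)
Record proc_inv (p : program A V R PC) (i : 'I_n) G (m : A -> V * tag)
    (mrb : seq mreq) ps (w : wproc) (ib : seq (A * (V * tag))) : Prop := ProcInv
  { pi_incr : incr (rob ps);
    pi_nxt : all (fun p => p.1 < nxt ps) (rob ps);
    pi_rob : rob_ok p i G (w_pc w) (Some \o rf ps) (sb_view (sb ps)) (rob ps)
               (pcr ps);
    pi_rf : w_rf w =1 rf ps;
    pi_sb : w_sb w = [seq (sb_a s, sb_v s) | s <- sb ps];
    pi_ib : w_ib w = [seq (x.1, x.2.1) | x <- ib];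
    pi_fits : forall a, sb_view (sb ps) a = NotFound ->
      fits (mem_lds a (rob ps)) (history a ib (m a));
    pi_sbG : all (fun s => G (sb_t s) == Some (sb_v s)) (sb ps);
    pi_fresh : forall k, nxt ps <= k -> G (inr (i, k)) = None;
    pi_ld : forall k a, (k, a) \in pmap ld_req mrb -> pending ps k a;
    pi_ld_uniq : uniq (unzip1 (pmap ld_req mrb));
    pi_st : forall a v t, (a, (v, t)) \in pmap st_req mrb ->
      ohead [seq s <- sb ps | sb_a s == a] = Some (SbEntry a v t true);
    pi_st_uniq : uniq (unzip1 (pmap st_req mrb)) }.

Lemma proc_inv_rob p i G G' m mrb ps w ib r pc' lf' :
  proc_inv p i G m mrb ps w ib ->
  (forall t v, G t = Some v -> G' t = Some v) ->
  (forall k, nxt ps <= k -> G' (inr (i, k)) = None) ->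
  let ps' := Proc pc' (rf ps) r (sb ps) lf' (nxt ps) in
  incr r -> all (fun p => p.1 < nxt ps) r ->
  rob_ok p i G' (w_pc w) (Some \o rf ps) (sb_view (sb ps)) r pc' ->
  (forall a, sb_view (sb ps) a = NotFound ->
    fits (mem_lds a r) (history a ib (m a))) ->
  (forall k a, (k, a) \in pmap ld_req mrb -> pending ps k a ->
    pending ps' k a) ->
  proc_inv p i G' m mrb ps' w ib.
Proof.
case=> ? ? ? ? ? ? ? HG ? Hp ? ? ? leG freshG ps' ? ? ? ? Hpend; split=> //=.
  by apply: sub_all HG => s /eqP /leG ->.
by move=> k a H; apply: Hpend (Hp _ _ H).
Qed.

(** Covers every way in which an execution ends: entry [k] is replaced, [l2] survives and [l2'] is
    flushed. An empty [l2'] means no flush, an empty [l2] a flush right after [k]. *)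
Lemma proc_inv_cut p i G m mrb ps w ib l1 k e e' l2 l2' pc' lf' :
  proc_inv p i G m mrb ps w ib -> rob ps = l1 ++ (k, e) :: l2 ++ l2' ->
  e_pc e' = e_pc e ->
  let rv := rv_after (Some \o rf ps) l1 in
  let fw := fw_after (sb_view (sb ps)) l1 in
  let ps' := Proc pc' (rf ps) (l1 ++ (k, e') :: l2) (sb ps) lf' (nxt ps) in
  entry_ok p i G rv fw k e' ->
  rob_ok p i G (e_npc e') (rv_step rv e') (fw_step fw e') l2 pc' ->
  (forall a, sb_view (sb ps) a = NotFound ->
    fits (mem_lds a (l1 ++ (k, e') :: l2)) (history a ib (m a))) ->
  (forall j a, (j, a) \in pmap ld_req mrb -> pending ps j a ->
    pending ps' j a) ->
  proc_inv p i G m mrb ps' w ib.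
Proof.
move=> Inv E Epc rv fw ps' ok' ok2 Hfits Hpend.
apply: (proc_inv_rob Inv) => //=; first exact: pi_fresh Inv.
- apply: (incr_upd (e := e)); apply: (@incr_catl _ l2').
  by rewrite -catA /= -E; apply: pi_incr Inv.
- by have := pi_nxt Inv; rewrite E !all_cat /= all_cat => /and4P [-> -> ->].
have := pi_rob Inv; rewrite E => /rob_ok_split [ok1 _ _].
by apply/rob_ok_split; rewrite Epc.
Qed.

(** Keeping the younger entries requires that their views changed only in the tolerated directions;
    flushing them requires nothing of the kind. *)
Lemma proc_inv_upd p i G m mrb ps w ib l1 k e e' l2 :
  proc_inv p i G m mrb ps w ib -> rob ps = l1 ++ (k, e) :: l2 ->
  e_pc e' = e_pc e ->
  let rv := rv_after (Some \o rf ps) l1 in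
  let fw := fw_after (sb_view (sb ps)) l1 in
  entry_ok p i G rv fw k e' ->
  (forall a, sb_view (sb ps) a = NotFound ->
    fits (mem_lds a (l1 ++ (k, e') :: l2)) (history a ib (m a))) ->
  (k \in unzip1 (pmap ld_req mrb) ->
   forall a, in_flight_at a e -> in_flight_at a e') ->
  (e_npc e' = e_npc e -> rv_le (rv_step rv e) (rv_step rv e') ->
   fw_le (fw_step fw e) (fw_step fw e') ->
   proc_inv p i G m mrb (rob_upd ps k e') w ib) /\
  proc_inv p i G m mrb (flush (rob_upd ps k e') k.+1 (e_npc e')) w ib.
Proof.
move=> Inv E Epc rv fw ok' Hfits Hfl; have I := pi_incr Inv.
have I' : incr (rob (rob_upd ps k e')).
  by rewrite (rob_upd_mid _ E I) /= (incr_upd (e := e)) // -E.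
have E' : rob (rob_upd ps k e') = l1 ++ (k, e') :: l2.
  by rewrite (rob_upd_mid _ E I).
have Hpend j a : (j, a) \in pmap ld_req mrb -> pending ps j a ->
    pending (rob_upd ps k e') j a.
  move=> Hj Hp; rewrite (rob_upd_mid _ E I).
  apply: (pending_upd E) Hp => Ej; apply: Hfl; apply/mapP.
  by rewrite -Ej; exists (j, a).
split.
  move=> Enpc Hrv Hfw; move: Hpend; rewrite (rob_upd_mid _ E I) => Hpend.
  apply: (@proc_inv_cut _ _ _ _ _ _ _ _ _ _ e e' l2 [::]); rewrite ?cats0 //.
  have := pi_rob Inv; rewrite E => /rob_ok_split [_ _].
  by rewrite Enpc; apply: rob_ok_le.
rewrite /flush (olderS_mid E' I') -cats1.
apply: (@proc_inv_cut _ _ _ _ _ ps _ _ _ _ e e' [::] l2) => //.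
  move=> a /Hfits; rewrite -cat1s catA mem_lds_cat; exact: fits_catl.
move=> j a Hj /(Hpend _ _ Hj) /(@pending_flush _ k.+1 (e_npc e')).
by rewrite /flush (olderS_mid E' I') -cats1.
Qed.

(** The first alternative serves loads completed by a bypass: as the store buffer has no store to
    [a], some entry of [l1] decides the search, and [mem_lds] ends there without reaching [k]. *)
Lemma fits_silent p i G m mrb ps w ib l1 k e e' l2 a :
  proc_inv p i G m mrb ps w ib -> rob ps = l1 ++ (k, e) :: l2 ->
  fw_after (sb_view (sb ps)) l1 a <> NotFound \/
    stops a e = stops a e' /\ done_ld a e = done_ld a e' ->
  sb_view (sb ps) a = NotFound ->
  fits (mem_lds a (l1 ++ (k, e') :: l2)) (history a ib (m a)).
Proof.
move=> Inv E H Ha; have := pi_fits Inv Ha; rewrite E.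
rewrite (@mem_lds_upd a l1 k e' e l2) //.
case: H => [H|[-> ->]]; [left | by right].
by move: (fw_after_cases (sb_view (sb ps)) l1 a); case: ifP => // _; rewrite Ha.
Qed.

Lemma pending_mid ps l1 k e l2 a : rob ps = l1 ++ (k, e) :: l2 ->
  incr (rob ps) -> pending ps k a = lf ps k || in_flight_at a e.
Proof.
move=> E I; have [_ H1 H2 _] : _ := incr_split (etrans (f_equal _ (esym E)) I).
rewrite /pending E has_cat /= eqxx /=; congr (_ || _).
have none l : all (fun p => p.1 != k) l ->
    has (fun p => (p.1 == k) && in_flight_at a p.2) l = false.
  by elim: l => //= q l IH /andP [/negPf -> /IH].
rewrite !none ?orbF //.
- by apply: sub_all H2 => q Hq; rewrite gtn_eqF.
- by apply: sub_all H1 => q Hq; rewrite ltn_eqF.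
Qed.

(** A hit comes from an executed store in the reorder buffer or from the store buffer, and the ghost
    map records both. *)
Lemma fw_after_G G (b : seq sbe) p i c rv l f a v t :
  all (fun s => G (sb_t s) == Some (sb_v s)) b ->
  rob_ok p i G c rv (sb_view b) l f ->
  fw_after (sb_view b) l a = Hit v t -> G t = Some v.
Proof.
move=> Gb; have : forall a v t, sb_view b a = Hit v t -> G t = Some v.
  move=> {}a {}v {}t H; have := sb_view_cases b a; rewrite H.
  case=> [b1 [s [b2 [E _ <- <- _]]]]; move: Gb.
  by rewrite E all_cat /= => /and3P [_ /eqP].
elim: l c rv (sb_view b) => [|[k e] l IH] c rv fw /= Hfw.
  by move=> _ /Hfw.
case=> _ ok1 ok2; apply: IH ok2 => a' v' t'; rewrite fw_step_rec.
move: ok1; rewrite /entry_ok.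
case: (e_ins e) => // [y val|y oa ov ot|y [b'|] [u|] t1|] //;
  try by move=> _ /Hfw.
case: (e_ex e) => //; try by move=> _ /Hfw.
case=> _ _ _ [vs _ [_ [<-] Gt]]; case: eqP => _; last exact: Hfw.
by case=> <- <-.
Qed.

(** * Steps of the out-of-order processor *)

Lemma proc_inv_fetch p i G m mrb ps w ib npc idx :
  proc_inv p i G m mrb ps w ib -> good_prediction p (pcr ps) npc ->
  nxt ps <= idx ->
  let ins := fetch p (pcr ps) in
  let e := Entry (pcr ps) npc (new_ins ins (inr (i, idx))) (new_ex ins) in
  proc_inv p i G m mrb
    (Proc npc (rf ps) (rcons (rob ps) (idx, e)) (sb ps) (lf ps) idx.+1) w ib.
Proof.
move=> Inv good le ins e; have lt q : q.1 < nxt ps -> q.1 < idx.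
  by move=> H; apply: leq_trans le.
have silent a : stops a e = false /\ done_ld a e = [::] \/ stops a e.
  by rewrite /e; case: (ins) => [x|x|x||]; [left|left|left|left|right].
case: (Inv) => ? Hn ok ? ? ? Hf ? fr Hp ? ? ?; split=> //=.
- rewrite /incr /unzip1 map_rcons -cats1 pairwise_cat /= !andbT.
  rewrite allrel1r all_map.
  apply/andP; split; last exact: pi_incr Inv.
  by apply: sub_all Hn => q /lt.
- by rewrite all_rcons ltnSn; apply: sub_all Hn => q /lt; apply: leqW.
- rewrite -cats1; apply/rob_ok_split; split=> //.
  move: good; rewrite /good_prediction /entry_ok /e /ins /=.
  case E: (fetch p (pcr ps)) => [x|x|x||] //= ->; split=> //.
  by split=> //; apply: fr.
- move=> a /Hf; rewrite -cats1 mem_lds_cat /=.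
  by case: (silent a) => [[-> ->]|->]; case: ifP => _; rewrite ?cats0.
- by move=> k le'; apply: fr; apply: leq_trans le (ltnW le').
- move=> k a /Hp; rewrite /pending /= has_rcons.
  by case/orP => ->; rewrite ?orbT.
Qed.

Lemma done_ldN a e : e_ex e <> Done -> done_ld a e = [::].
Proof.
by case: e => pc npc [x v|x [b|] [v|] [t|]|x oa ov t||] [].
Qed.

Ltac split_rob H Inv E ok :=
  have [l1 [l2 E]] := rob_atP H (pi_incr Inv);
  have := pi_rob Inv; rewrite E => /rob_ok_split [_ ok _].

Lemma proc_inv_NmEx p i G m mrb ps w ib idx pc npc x val0 vs nextpc val :
  proc_inv p i G m mrb ps w ib ->
  rob_at ps idx = Some (Entry pc npc (RNm x val0) Idle) ->
  ready ps idx (nm_srcs x) vs ->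
  nm_op x pc vs = (nextpc, val) ->
  proc_inv p i G m mrb
      (let ps' := rob_upd ps idx (Entry pc nextpc (RNm x (Some val)) Done) in
       if nextpc != npc then flush ps' idx.+1 nextpc else ps') w ib.
Proof.
move=> Inv H; split_rob H Inv E ok => /(ready_mid E (pi_incr Inv)) Hr Hop /=.
case: ok => /= Hf Hval; subst val0.
have [||||keep fl] := proc_inv_upd
  (e' := Entry pc nextpc (RNm x (Some val)) Done) Inv E.
- by [].
- by split=> //; exists vs, val.
- by move=> a; apply: (fits_silent Inv E); right.
- by [].
case: eqP => [Enpc|_] //; apply: keep => //= [r v|a]; last by constructor 1.
by rewrite /rv_step /=; case: eqP.
Qed.

Lemma proc_inv_LdAddr p i G m mrb ps w ib idx pc npc x v t vs :
  proc_inv p i G m mrb ps w ib ->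
  rob_at ps idx = Some (Entry pc npc (RLd x None v t) Idle) ->
  ready ps idx (ld_srcs x) vs ->
  proc_inv p i G m mrb
      (rob_upd ps idx (Entry pc npc (RLd x (Some (ld_addr x vs)) v t) Idle))
      w ib.
Proof.
move=> Inv H; split_rob H Inv E ok => /(ready_mid E (pi_incr Inv)) Hr /=.
case: ok => /= Hf Hnpc _ Ht.
have [||||keep _] := proc_inv_upd
  (e' := Entry pc npc (RLd x (Some (ld_addr x vs)) v t) Idle) Inv E.
- by [].
- by split=> // a [<-]; exists vs.
- by move=> a; apply: (fits_silent Inv E); right; rewrite !done_ldN.
- by [].
by apply: keep => // a; constructor 1.
Qed.

Lemma proc_inv_LdPred p i G m mrb ps w ib idx pc npc x a ex v :
  proc_inv p i G m mrb ps w ib ->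
  rob_at ps idx = Some (Entry pc npc (RLd x a None None) ex) ->
  proc_inv p i G m mrb
    (rob_upd ps idx (Entry pc npc (RLd x a (Some v) None) ex)) w ib.
Proof.
move=> Inv H; split_rob H Inv E ok => /=.
case: ok => /= Hf Hnpc Ha Hex.
have [||||keep _] := proc_inv_upd
  (e' := Entry pc npc (RLd x a (Some v) None) ex) Inv E.
- by [].
- by split=> //; case: (ex) Hex => //= -[b [u [t []]]].
- by move=> b; apply: (fits_silent Inv E); right; split.
- by move=> _ b; rewrite /in_flight_at.
apply: keep => //= [r u|b]; last by constructor 1.
by rewrite /rv_step /=; case: eqP.
Qed.

Lemma proc_inv_LdBypass p i G m mrb ps w ib idx pc npc x a v vs res t :
  proc_inv p i G m mrb ps w ib ->
  rob_at ps idx = Some (Entry pc npc (RLd x (Some a) v None) Idle) ->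
  ready ps idx (ld_srcs x) vs ->
  findBypass ps idx a = Hit res t ->
  proc_inv p i G m mrb
      (let ps' :=
         rob_upd ps idx (Entry pc npc (RLd x (Some a) (Some res) (Some t)) Done)
       in
       if mispredicted v res then flush ps' idx.+1 npc else ps') w ib.
Proof.
move=> Inv H; split_rob H Inv E ok => _.
rewrite (findBypass_mid a E (pi_incr Inv)) => Hit /=.
case: ok => /= Hf Hnpc Ha Hex.
have [||||keep fl] := proc_inv_upd
  (e' := Entry pc npc (RLd x (Some a) (Some res) (Some t)) Done) Inv E.
- by [].
- split=> //=; exists a, res, t; split=> //; last by left.
  have := pi_rob Inv; rewrite E => /rob_ok_split [ok1 _ _].
  exact: fw_after_G (pi_sbG Inv) ok1 Hit.
- move=> b; apply: (fits_silent Inv E).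
  case: (altP (a =P b)) => [<-|Hb]; first by left; rewrite Hit.
  by right; rewrite done_ldN // /done_ld /= (negPf Hb).
- by [].
case: ifP => [_|/negbT]; first exact: fl.
move=> Hmis; apply: keep => //= [r u|b]; last by constructor 1.
rewrite /rv_step /=; case: eqP => // _; case: v Hmis {H E Hex fl} => //= v'.
by rewrite negbK => /eqP ->.
Qed.

Lemma proc_inv_LdReq p i G m mrb ps w ib idx pc npc x a v vs :
  proc_inv p i G m mrb ps w ib ->
  rob_at ps idx = Some (Entry pc npc (RLd x (Some a) v None) Idle) ->
  ready ps idx (ld_srcs x) vs ->
  findBypass ps idx a = NotFound ->
  ~~ lf ps idx ->
  proc_inv p i G m (mrb ++ [:: ReqLd idx a])
      (rob_upd ps idx (Entry pc npc (RLd x (Some a) v None) Exe)) w ib.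
Proof.
move=> Inv H; split_rob H Inv E ok => _.
rewrite (findBypass_mid a E (pi_incr Inv)) => NF Hlf.
case: ok => /= Hf Hnpc Ha Hex.
have [||||keep _] := proc_inv_upd
  (e' := Entry pc npc (RLd x (Some a) v None) Exe) Inv E.
- by [].
- by split=> //=; split=> //; exists a.
- by move=> b; apply: (fits_silent Inv E); right; rewrite !done_ldN.
- by [].
have {keep} Inv' : proc_inv p i G m mrb
    (rob_upd ps idx (Entry pc npc (RLd x (Some a) v None) Exe)) w ib.
  by apply: keep => // b; constructor 1.
case: Inv' => ? ? ? ? ? ? ? ? ? Hp Hu Hs Hsu; split=> //.
- move=> k b; rewrite pmap_cat mem_cat => /orP [/Hp //|/=].
  rewrite inE => /eqP [-> ->]; rewrite (rob_upd_mid _ E (pi_incr Inv)).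
  by rewrite /pending /= has_cat /= eqxx /in_flight_at /= eqxx !orbT.
(* An earlier request for [idx] would be pending, but the load was [Idle] and the guard excludes its
   [lf] bit. *)
- rewrite pmap_cat /unzip1 map_cat cats1 rcons_uniq Hu andbT.
  apply/mapP => -[[k b] /(pi_ld Inv) Hk /= Ek]; move: Hk.
  by rewrite -Ek (pending_mid _ E (pi_incr Inv)) (negPf Hlf).
- by rewrite pmap_cat cats0.
- by rewrite pmap_cat cats0.
Qed.

(** Here [l] lies behind the newly executed store to [a], and [fw], [fw'] are the views without and
    with it. Only loads of [a] before the next store to [a] can notice the difference, and
    [affected_in] lists those not [Idle]: waiting ones lose their claim to [NotFound] by becoming
    [ReEx], and the first [Done] one is flushed with all that follows. The loads of [a] need no
    bound in the fourth conclusion, since the new store cuts them off. *)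
Lemma replay_ok p i G a l : forall pre ps c rv fw fw',
  rob ps = pre ++ l -> incr (rob ps) -> rob_ok p i G c rv fw l (pcr ps) ->
  (forall b, b <> a -> fw b = fw' b) ->
  let ps' := replay ps (affected_in l a) in
  exists l', [/\
    ps' = Proc (pcr ps') (rf ps) (pre ++ l') (sb ps) (lf ps') (nxt ps),
    exists s, unzip1 l = unzip1 l' ++ s,
    rob_ok p i G c rv fw' l' (pcr ps'),
    forall b, b <> a -> exists s, mem_lds b l = mem_lds b l' ++ s
    & forall k b, pending ps k b -> pending ps' k b].
Proof.
elim: l => [|[k e] l IH] pre ps c rv fw fw' E I /=.
  move=> Ec _; exists [::]; split=> //; first by rewrite -E; case: (ps).
  - by exists [::].
  - by exists [::].
case=> Epc ok1 ok2 Hfw; subst c.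
(* The common inductive step: the head survives as [e'], looking the same to younger entries, and
   joins [pre]. *)
have step e' ps1 : pcr ps1 = pcr ps -> rf ps1 = rf ps -> sb ps1 = sb ps ->
    nxt ps1 = nxt ps -> rob ps1 = pre ++ (k, e') :: l ->
    (forall k b, pending ps k b -> pending ps1 k b) ->
    e_pc e' = e_pc e -> e_npc e' = e_npc e ->
    rv_step rv e' = rv_step rv e -> fw_step fw e' = fw_step fw e ->
    (forall b, stops b e' = stops b e /\ done_ld b e' = done_ld b e) ->
    entry_ok p i G rv fw' k e' ->
    let ps' := replay ps1 (affected_in l a) in
    exists l', [/\
      ps' = Proc (pcr ps') (rf ps) (pre ++ l') (sb ps) (lf ps') (nxt ps),
      exists s, unzip1 ((k, e) :: l) = unzip1 l' ++ s,
      rob_ok p i G (e_pc e) rv fw' l' (pcr ps'),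
      forall b, b <> a -> exists s, mem_lds b ((k, e) :: l) = mem_lds b l' ++ s
      & forall k b, pending ps k b -> pending ps' k b].
  move=> E1 E2 E3 E4 E5 E6 E7 E8 E9 E10 E11 ok'.
  have I1 : incr (rob ps1) by rewrite E5 (incr_upd (e := e)) // -E.
  have [||||l' [H1 [s H2] H3 H4 H5]] := IH (rcons pre (k, e')) ps1 (e_npc e')
    (rv_step rv e') (fw_step fw e') (fw_step fw' e').
  - by rewrite cat_rcons.
  - by [].
  - by rewrite E1 E8 E9 E10.
  - by move=> b /Hfw Hb; case: (fw_step_cases e' b) => [[u _ Hu]|Hu];
      rewrite !Hu.
  exists ((k, e') :: l'); split.
  - by rewrite {1}H1 cat_rcons E2 E3 E4.
  - by exists s; rewrite /= H2.
  - by rewrite /= E7; split.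
  - move=> b /H4 [s' Hs']; case: (E11 b) => S D; rewrite /= S D.
    case: ifP => _; first by exists [::].
    by exists s'; rewrite Hs' catA.
  - by move=> j b /E6 /H5.
have skip : entry_ok p i G rv fw' k e -> _ := @step e ps erefl erefl erefl erefl
  E (fun _ _ H => H) erefl erefl erefl erefl (fun _ => conj erefl erefl).
move: E ok1 ok2 step skip.
case: e => pc npc ins ex /= E ok1 ok2 step skip.
case: ins E ok1 ok2 step skip =>
  [x val|x oa ov ot|x oa ov t||] E ok1 ok2 step skip.
- exact: skip ok1.
- case: ok1 => /= Hf Hnpc Ha Hex.
  case: (oa =P Some a) => [Ea|Na]; last first.
    have ok' : entry_ok p i G rv fw' k (Entry pc npc (RLd x oa ov ot) ex).
      split=> //=; case: ex Hex {E ok2 step skip} => // [[-> [b Eb Fb]]|].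
        split=> //; exists b => //; rewrite -Hfw // => Eab.
        by rewrite Eb Eab in Na.
      case=> b [v [t [Eb -> -> Gt Fb]]]; exists b, v, t; split=> //.
      by rewrite -Hfw // => Eab; rewrite Eb Eab in Na.
    move: (skip ok'); case: (oa) Na => [b|] Nb; case: (ex) => //.
    + by case: eqP => // Eb; case: Nb; rewrite Eb.
    + by case: eqP => // Eb; case: Nb; rewrite Eb.
    + by case: eqP => // Eb; case: Nb; rewrite Eb.
  subst oa; have at_k := rob_at_mid E I.
  have reex := @step (Entry pc npc (RLd x (Some a) ov ot) ReEx)
    (rob_upd ps k (Entry pc npc (RLd x (Some a) ov ot) ReEx))
    erefl erefl erefl erefl.
  case: ex E Hex ok2 step skip reex at_k => E Hex ok2 step skip reex at_k.
  - by apply: skip; split.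
  - rewrite eqxx /= at_k; apply: reex => //.
    + by rewrite (rob_upd_mid _ E I).
    + move=> j b; rewrite (rob_upd_mid _ E I); exact: (pending_upd E).
    + by split=> //; case: Hex => -> _; split=> //; exists a.
  - rewrite eqxx /= at_k; apply: reex => //.
    + by rewrite (rob_upd_mid _ E I).
    + move=> j b; rewrite (rob_upd_mid _ E I); exact: (pending_upd E).
  - rewrite eqxx /= at_k /flush (older_mid E I); exists [::]; split=> //=.
    + by rewrite cats0.
    + by exists (k :: unzip1 l).
    + by move=> b _; eexists.
    + by move=> j b /(pending_flush k pc); rewrite /flush (older_mid E I).
- case: ok1 => /= Hf Hnpc Et Hex.
  case: (oa =P Some a) => [Ea|Na]; last first.
    move: (skip (And4 Hf Hnpc Et Hex)); case: (oa) Na => // b Nb.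
    by case: eqP => // Eb; case: Nb; rewrite Eb.
  subst oa; rewrite eqxx /=.
  (* With its address computed, this store has been executed. It decides [a] for all younger
     entries, so the two views coincide behind it and everything is kept. *)
  exists ((k, Entry pc npc (RSt x (Some a) ov t) ex) :: l); split=> //.
  + by rewrite -E; case: (ps).
  + by exists [::]; rewrite cats0.
  + split=> //; apply: rob_ok_le ok2 => // b; constructor 1.
    rewrite !fw_step_rec /=; case: (ex) Hex => // [[]|] // [vs _ [_ -> _]].
    by case: eqP => // Nb; apply: Hfw => Eb; case: Nb.
  + by move=> b _; exists [::]; rewrite cats0.
- exact: skip ok1.
- exact: skip ok1.
Qed.

Lemma incr_prefix l l' s : unzip1 l = unzip1 l' ++ s -> incr l -> incr l'.
Proof. by rewrite /incr => ->; rewrite pairwise_cat => /and3P []. Qed.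

Lemma proc_inv_StEx p i G m mrb ps w ib idx pc npc x a0 v0 t vs :
  proc_inv p i G m mrb ps w ib ->
  rob_at ps idx = Some (Entry pc npc (RSt x a0 v0 t) Idle) ->
  ready ps idx (st_srcs x) vs ->
  exists G', [/\ forall t v, G t = Some v -> G' t = Some v,
    forall j k, j != i -> G' (inr (j, k)) = G (inr (j, k))
    & proc_inv p i G' m mrb
        (let a := st_addr x vs in
         let ins := RSt x (Some a) (Some (st_data x vs)) t in
         replay (rob_upd ps idx (Entry pc npc ins Done))
                (findAffectedLd ps idx a)) w ib].
Proof.
move=> Inv H Hr; have I := pi_incr Inv; have [l1 [l2 E]] := rob_atP H I.
move: Hr => /(ready_mid E I) Hr.
have := pi_rob Inv; rewrite E => /rob_ok_split [ok1 ok ok2].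
case: ok => /= Hf Hnpc Et [Ea Gt]; subst a0 t.
set a := st_addr x vs; set v := st_data x vs.
set e' := Entry _ _ _ Done.
have I' := I; rewrite E in I'; case: (incr_split I') => _ lt1 gt2 _.
(* The tag was free because the store was [Idle], so this extends [G], and only at a tag of
   processor [i]. *)
pose G' (t : tag) := if t == inr (i, idx) then Some v else G t.
have leG t u : G t = Some u -> G' t = Some u.
  by rewrite /G'; case: eqP => // ->; rewrite Gt.
have newG k : k != idx -> G (inr (i, k)) = None -> G' (inr (i, k)) = None.
  by move=> Hk; rewrite /G'; case: eqP => // -[Ek]; rewrite Ek eqxx in Hk.
have idx_lt : idx < nxt ps.
  by move: (pi_nxt Inv); rewrite E all_cat /= => /and3P [].
have ok' rv fw : [seq rv r | r <- st_srcs x] = [seq Some u | u <- vs] ->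
    entry_ok p i G' rv fw idx e'.
  by move=> Hrv; split=> //; exists vs => //; rewrite /G' eqxx.
exists G'; split=> //.
  move=> j k Hj; rewrite /G'; case: eqP => // -[Eji].
  by rewrite Eji eqxx in Hj.
rewrite /findAffectedLd (younger_mid E I) (rob_upd_mid _ E I) /=.
have [||||l' [-> [s Es] ok3 Hlds Hpend]] := @replay_ok p i G' a l2
  (rcons l1 (idx, e')) (set_rob ps (l1 ++ (idx, e') :: l2)) npc
  (rv_after (Some \o rf ps) l1) (fw_after (sb_view (sb ps)) l1)
  (fw_step (fw_after (sb_view (sb ps)) l1) e').
- by rewrite cat_rcons.
- exact: incr_upd I'.
- apply: (rob_ok_mono leG) ok2 => // [k Hk|b]; last by constructor 1.
  apply: newG; move: gt2; rewrite -(all_map (fun p => p.1) (fun k => idx < k)).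
  by move=> /allP /(_ _ Hk); rewrite neq_ltn orbC => ->.
- by move=> b Hb; rewrite fw_step_rec /=; case: eqP => // Eb; case: Hb.
have key : unzip1 (rob ps) = unzip1 (rcons l1 (idx, e') ++ l') ++ s.
  by rewrite E cat_rcons /unzip1 !map_cat /= -/(unzip1 l2) Es -catA.
apply: (proc_inv_rob Inv leG).
- move=> k le; apply: newG (pi_fresh Inv le).
  by rewrite neq_ltn (leq_trans idx_lt le) orbT.
- exact: incr_prefix key I.
- move: (pi_nxt Inv); rewrite -!(all_map (fun p => p.1) (fun k => k < nxt ps)).
  by rewrite -/(unzip1 _) key all_cat => /andP [].
- rewrite cat_rcons; apply/rob_ok_split; split=> //; last exact: ok'.
  apply: (rob_ok_mono leG) ok1 => // [k Hk|b]; last by constructor 1.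
  apply: newG; move: lt1; rewrite -(all_map (fun p => p.1) (fun k => k < idx)).
  by move=> /allP /(_ _ Hk); rewrite neq_ltn => ->.
- move=> b /(pi_fits Inv); rewrite E cat_rcons !mem_lds_cat /=.
  case: (b =P a) => [->|Hb].
    have -> : stops a e' by rewrite /stops fw_step_rec /= eqxx.
    rewrite (_ : (if _ then [::] else [::]) = [::]) ?cats0; last by case: ifP.
    exact: fits_catl.
  have -> : stops b e' = false.
    by rewrite /stops fw_step_rec /=; case: eqP => // Eb; case: Hb.
  have [s' ->] := Hlds _ Hb.
  by case: ifP => //= _; rewrite catA; apply: fits_catl.
- move=> k b _ Hp; apply: Hpend.
  by apply: (pending_upd E) Hp => _; rewrite /in_flight_at.
Qed.

Lemma proc_inv_StReq p i G m mrb ps w ib sb1 a v t sb2 :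
  proc_inv p i G m mrb ps w ib ->
  sb ps = sb1 ++ SbEntry a v t false :: sb2 ->
  a \notin [seq sb_a s | s <- sb1] ->
  proc_inv p i G m (mrb ++ [:: ReqSt a v t])
    (set_sb ps (sb1 ++ SbEntry a v t true :: sb2)) w ib.
Proof.
move=> Inv E Ha; have view b :
    sb_view (sb1 ++ SbEntry a v t true :: sb2) b = sb_view (sb ps) b.
  by rewrite E -!(cat1s _ sb2) !sb_view_cat !sb_view1.
have none : [seq s <- sb1 | sb_a s == a] = [::].
  apply: (filter_none (b := fun s => sb_a s != a)) => //.
  rewrite -(all_map (@sb_a A V n) (fun b => b != a)).
  by apply/allP => b Hb; apply: contraNneq Ha => <-.
case: (Inv) => ? ? ok ? Hsb ? Hf HG ? Hp Hu Hs Hsu; split=> //=.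
- by apply: rob_ok_le ok => // b; constructor 1; rewrite view.
- by rewrite Hsb E !map_cat.
- by move=> b; rewrite view => /Hf.
- by move: HG; rewrite E !all_cat.
- by rewrite pmap_cat cats0.
- by rewrite pmap_cat cats0.
- move=> b u t'; rewrite pmap_cat mem_cat => /orP [/Hs|/=].
    rewrite E !filter_cat /=; case: (altP (a =P b)) => // <-.
    by rewrite none.
  rewrite inE => /eqP [-> -> ->]; by rewrite filter_cat none /= eqxx.
(* A request already under way for [a] would mean that the oldest store to [a] is marked as
   issued. *)
- rewrite pmap_cat /unzip1 map_cat cats1 rcons_uniq Hsu andbT.
  apply/mapP => -[[b [u t']] /Hs /= + Ea]; rewrite -Ea.
  by rewrite E filter_cat none /= eqxx.
Qed.

(** A store with a computed address has been executed, so where the search gives up [mem_lds] ends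
    as well. The search passes a Reconcile, where [mem_lds] ends, and so checks at least the loads
    that matter. *)
Lemma stale_inP p i G c rv fw l f a t : rob_ok p i G c rv fw l f ->
  if stale_in l a t is Some k then exists l1 e l2,
    l = l1 ++ (k, e) :: l2 /\ all (fun x => x.2 == t) (mem_lds a l1)
  else all (fun x => x.2 == t) (mem_lds a l).
Proof.
elim: l c rv fw => //= -[k e] l IH c rv fw [_ ok1 /IH {}IH].
have skip : all (fun x => x.2 == t) (done_ld a e) ->
    if stale_in l a t is Some k' then exists l1 e' l2,
      (k, e) :: l = l1 ++ (k', e') :: l2 /\
      all (fun x => x.2 == t) (mem_lds a l1)
    else all (fun x => x.2 == t) (mem_lds a ((k, e) :: l)).
  move=> Hd; case: (stale_in l a t) IH => [j|] IH; last first.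
    by rewrite /=; case: ifP => //; rewrite all_cat Hd IH.
  case: IH => l1 [e' [l2 [-> Hl1]]]; exists ((k, e) :: l1), e', l2; split=> //=.
  by case: ifP => //; rewrite all_cat Hd Hl1.
case: e ok1 skip => pc npc [x val|x oa ov ot|x oa ov u||] ex ok1 skip.
- exact: skip.
- move: ok1 skip; case: ex => ok1 skip; try by
    case: oa ok1 skip => [b|] ok1 skip; case: ot ok1 skip => [u|] ok1 skip;
    apply: skip; rewrite done_ldN.
  case: ok1 => _ _ _ [b [v [u [-> -> -> _ _]]]] in skip *.
  rewrite /=; case: ifP => Hb.
    by exists [::]; do 2 eexists.
  apply: skip; rewrite /done_ld /=; case: ifP => // Eb.
  by move: Hb; rewrite Eb /= => /negbFE ->.
- case: oa ok1 skip => [b|] ok1 skip; last exact: skip.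
  rewrite /=; case: (b =P a) => [Eb|_]; last exact: skip.
  case: ex ok1 skip => -[_ _ _]; try by case.
  case=> vs _ [_ -> _] _.
  by rewrite /= /stops fw_step_rec /= Eb eqxx.
- exact: skip.
- exact: skip.
Qed.

Lemma has_split {T} (q : pred T) s : has q s ->
  exists s1 x s2, s = s1 ++ x :: s2 /\ q x.
Proof.
elim: s => //= x s IH; case: (boolP (q x)) => [Hx _|_ /= H].
  by exists [::], x, s.
have [s1 [y [s2 [-> Hy]]]] := IH H.
by exists (x :: s1), y, s2.
Qed.

Lemma set_rob_id ps : set_rob ps (rob ps) = ps.
Proof. by case: ps. Qed.

Lemma proc_inv_drop_ld p i G m b1 b2 idx a ps w ib :
  proc_inv p i G m (b1 ++ ReqLd idx a :: b2) ps w ib ->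
  [/\ proc_inv p i G m (b1 ++ b2) ps w ib, pending ps idx a
    & idx \notin unzip1 (pmap ld_req (b1 ++ b2))].
Proof.
case=> ? ? ? ? ? ? ? ? ? Hp Hu Hs Hsu.
move: Hu; rewrite pmap_cat /unzip1 map_cat /= -cat1s uniq_catCA /=.
rewrite -map_cat -pmap_cat.
case/andP => Hidx Hu; split=> //; last first.
  by apply: Hp; rewrite pmap_cat mem_cat /= inE eqxx orbT.
split=> //.
- move=> k b; rewrite pmap_cat mem_cat => H; apply: Hp.
  by rewrite pmap_cat mem_cat /= inE; case/orP: H => ->; rewrite ?orbT.
- by move=> b v t H; apply: Hs; move: H; rewrite !pmap_cat.
- by move: Hsu; rewrite !pmap_cat.
Qed.

(** The returned pair is the last element of the history, so it may follow all older memory loads of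
    [a]. The younger ones that survive bear its tag, hence its value, and merely repeat it. *)
Lemma proc_inv_respLd p i G m b1 b2 ps w ib idx a :
  G (m a).2 = Some (m a).1 ->
  proc_inv p i G m (b1 ++ ReqLd idx a :: b2) ps w ib ->
  proc_inv p i G m (b1 ++ b2) (respLd ps idx (m a).1 (m a).2) w ib.
Proof.
move=> Gm /proc_inv_drop_ld []; set mrb := b1 ++ b2 => Inv Hp Hidx.
have I := pi_incr Inv; rewrite /respLd; case Elf: (lf ps idx).
  have := pi_rob Inv; have := pi_fits Inv; have := pi_nxt Inv => H1 H2 H3.
  rewrite -(set_rob_id ps) /set_lf /=.
  apply: (proc_inv_rob Inv) => //; first exact: pi_fresh Inv.
  (* Clearing the bit could only harm another request with the same index, which uniqueness rules
     out. *)
  move=> k b Hk; rewrite /pending /=; case: eqP => // Ek.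
  by case/mapP: Hidx; exists (k, b).
move: Hp; rewrite /pending Elf /=.
case/has_split => l1 [[k e] [l2 [E /andP [/= /eqP Ek Hfl]]]]; subst k.
rewrite (rob_at_mid E I).
have := pi_rob Inv; rewrite E => /rob_ok_split [ok1 ok ok2].
move: Hfl; rewrite /in_flight_at.
case: e E ok1 ok ok2 => pc npc [x val|x [b|] v t0|x oa ov t0||] ex //=;
  case: ex => // E ok1 [/= Hf Hnpc Ha [Et0 Fa]] ok2 /eqP Eb;
  subst b t0; last first.
  have [||||keep _] := proc_inv_upd
    (e' := Entry pc npc (RLd x (Some a) v None) Idle) Inv E.
  - by [].
  - by split.
  - by move=> b; apply: (fits_silent Inv E); right; rewrite !done_ldN.
  - by rewrite (negPf Hidx).
  by apply: keep => // b; constructor 1.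
case: Fa => _ [<-] Fa.
set e' := Entry pc npc (RLd x (Some a) (Some (m a).1) (Some (m a).2)) Done.
set rv := rv_after _ _ in ok2 Ha; set fw := fw_after _ _ in ok2 Fa.
have ok' : entry_ok p i G rv fw idx e'.
  by split=> //; exists a, (m a).1, (m a).2; split=> //; right.
have nostop : has (fun q => stops a q.2) l1 = false.
  by move: (fw_after_cases (sb_view (sb ps)) l1 a); case: ifP.
have Hfits c rv' fw' l3 f : (exists s, l2 = l3 ++ s) ->
    rob_ok p i G c rv' fw' l3 f ->
    all (fun y => y.2 == (m a).2) (mem_lds a l3) -> forall b,
    sb_view (sb ps) b = NotFound ->
    fits (mem_lds b (l1 ++ (idx, e') :: l3)) (history b ib (m b)).
  case=> s El2 ok3 Hl3 b /(pi_fits Inv); rewrite E El2.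
  case: (altP (b =P a)) => [->|Hb] Hfit; last first.
    move: Hfit; rewrite -cat_cons catA mem_lds_cat => /fits_catl.
    rewrite (@mem_lds_upd b l1 idx
      (Entry pc npc (RLd x (Some a) v None) Exe) e') //; right; split=> //.
    by rewrite [LHS]done_ldN // /done_ld /= eq_sym (negPf Hb).
  have all_ma : mem_lds a l3 = nseq (size (mem_lds a l3)) (m a).
    apply/all_pred1P/allP => y Hy; have [Gy _] := mem_lds_ok ok3 Hy.
    move/allP: Hl3 => /(_ y Hy) /eqP Ey; move: Gm; rewrite -Ey Gy => -[E1].
    by rewrite /= [y]surjective_pairing E1 Ey -surjective_pairing.
  rewrite mem_lds_cat nostop /= /done_ld /= eqxx all_ma -surjective_pairing /=.
  (* One copy for the load at [idx], and one for each surviving younger load. *)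
  apply: (@fits_rcons _ _ _ _ (size (mem_lds a l3)).+1).
  by move: Hfit; rewrite mem_lds_cat => /fits_catl.
have ok3 : ~~ mispredicted v (m a).1 ->
    rob_ok p i G (e_npc e') (rv_step rv e') (fw_step fw e') l2 (pcr ps).
  move=> Hmis; apply: rob_ok_le ok2 => [r u|b]; last by constructor 1.
  rewrite /rv_step /=; case: eqP => // _.
  by case: (v) Hmis => //= v'; rewrite negbK => /eqP ->.
set ps1 := rob_upd ps idx e'.
have E1 : rob ps1 = l1 ++ (idx, e') :: l2 by rewrite /ps1 (rob_upd_mid _ E I).
have I1 : incr (rob ps1).
  by rewrite E1; move: I; rewrite E; apply: incr_upd.
have Hpend j b : (j, b) \in pmap ld_req mrb -> pending ps j b ->
    pending ps1 j b.
  move=> Hj Hp; rewrite /ps1 (rob_upd_mid _ E I).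
  apply: (pending_upd E) Hp => Ej; case/mapP: Hidx.
  by rewrite -Ej; exists (j, b).
rewrite -/ps1; case: ifP => [_|/negbT /ok3 {}ok3].
  rewrite /flush (olderS_mid E1 I1) -cats1.
  apply: (@proc_inv_cut p i G m mrb ps w ib _ _ _ e' [::] l2) E _ _ _ _ _
    => //.
    by apply: (Hfits npc rv fw [::] npc) => //; exists l2.
  move=> j b Hj /(Hpend _ _ Hj) /(pending_flush idx.+1 npc).
  by rewrite /flush (olderS_mid E1 I1) -cats1.
rewrite /findStaleLd (younger_mid E1 I1).
have := stale_inP a (m a).2 ok3.
case: stale_in => [k [l3 [ek [l4 [El2 Hl3]]]]|Hl].
  have E2 : rob ps1 = (l1 ++ (idx, e') :: l3) ++ (k, ek) :: l4.
    by rewrite E1 El2 -catA.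
  rewrite /flush_at (rob_at_mid E2 I1) /flush (older_mid E2 I1).
  have E3 := E; rewrite El2 in E3.
  move: ok3; rewrite El2 => /rob_ok_split [ok3 _ _].
  apply: (@proc_inv_cut p i G m mrb ps w ib _ _ _ e' l3 ((k, ek) :: l4))
    E3 _ _ _ _ _ => //.
  - by apply: (Hfits _ _ _ _ _ _ ok3 Hl3); exists ((k, ek) :: l4).
  move=> j b Hj /(Hpend _ _ Hj) /(pending_flush k (e_pc ek)).
  by rewrite /flush (older_mid E2 I1).
move: Hpend; rewrite /ps1 (rob_upd_mid _ E I) => Hpend.
have E3 := E; rewrite -[l2]cats0 in E3.
apply: (@proc_inv_cut p i G m mrb ps w ib _ _ _ e' l2 [::]) E3 _ _ _ _ _
  => //.
by apply: (Hfits _ _ _ _ _ _ ok3 Hl); exists [::]; rewrite cats0.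
Qed.

(** * Commits *)

Lemma history_without a b (ib : seq (A * (V * tag))) x :
  history b [seq y <- ib | y.1 != a] x =
  if b == a then [:: x] else history b ib x.
Proof.
rewrite /history -filter_predI; case: (altP (b =P a)) => [->|Hb].
  by rewrite (eq_filter (a2 := pred0)) ?filter_pred0 // => y /=; case: eqP.
congr (rcons (map _ _) _); apply: eq_filter => y /=.
by case: eqP => // ->; rewrite Hb.
Qed.

Lemma filter_split a (ib : seq (A * (V * tag))) h1 z h2 :
  [seq y.2 | y <- ib & y.1 == a] = h1 ++ z :: h2 ->
  exists ib1 ib2, ib = ib1 ++ (a, z) :: ib2 /\
    [seq y.2 | y <- ib2 & y.1 == a] = h2.
Proof.
elim: ib h1 => [|[b y] ib IH] h1 /=; first by case: h1.
case: eqP => [->|_] /=; last first.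
  by move=> /IH [ib1 [ib2 [-> H]]]; exists ((b, y) :: ib1), ib2.
case: h1 => [[-> H]|y' h1 [_ /IH [ib1 [ib2 [-> H]]]]].
  by exists [::], ib.
by exists ((a, y) :: ib1), ib2.
Qed.

Lemma map_SomeK (f g : R -> V) rs vs : g =1 f ->
  [seq (Some \o f) r | r <- rs] = [seq Some v | v <- vs] ->
  vs = [seq g r | r <- rs].
Proof.
by move=> fg; elim: rs vs => [|r rs IH] [|v vs] //= [<- /IH <-]; rewrite fg.
Qed.

(** What the second entry saw through the head must now be offered by the register file and the
    store buffer; [s] is what the commit appends to the latter. *)
Lemma proc_inv_pop p i G m mrb ps w w' ib ib' k e r rf' s :
  proc_inv p i G m mrb ps w ib -> rob ps = (k, e) :: r ->
  (forall a, ~~ in_flight_at a e) ->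
  w_pc w' = e_npc e -> w_rf w' =1 rf' ->
  w_sb w' = [seq (sb_a s, sb_v s) | s <- sb ps ++ s] ->
  w_ib w' = [seq (x.1, x.2.1) | x <- ib'] ->
  rv_le (rv_step (Some \o rf ps) e) (Some \o rf') ->
  fw_le (fw_step (sb_view (sb ps)) e) (sb_view (sb ps ++ s)) ->
  all (fun s => G (sb_t s) == Some (sb_v s)) s ->
  (forall a, sb_view (sb ps ++ s) a = NotFound ->
    fits (mem_lds a r) (history a ib' (m a))) ->
  proc_inv p i G m mrb
    (Proc (pcr ps) rf' r (sb ps ++ s) (lf ps) (nxt ps)) w' ib'.
Proof.
case=> HI Hn ok _ _ _ _ HG fr Hp ? Hs ? E Hfl Epc Erf Esb Eib Hrv Hfw Gs Hfits.
rewrite E in HI Hn ok; split=> //=.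
- by move: HI; rewrite -cat1s => /incr_catr.
- by case/andP: Hn.
- by case: ok => _ _ ok; rewrite Epc; apply: rob_ok_le ok.
- by rewrite all_cat HG Gs.
- move=> j a /Hp; rewrite /pending E /= (negPf (Hfl a)) andbF; exact.
- by move=> a v t /Hs; rewrite filter_cat; case: filter.
Qed.

Lemma proc_inv_pop0 p i G m mrb ps w w' ib ib' k e r rf' :
  proc_inv p i G m mrb ps w ib -> rob ps = (k, e) :: r ->
  (forall a, ~~ in_flight_at a e) ->
  w_pc w' = e_npc e -> w_rf w' =1 rf' -> w_sb w' = w_sb w ->
  w_ib w' = [seq (x.1, x.2.1) | x <- ib'] ->
  rv_le (rv_step (Some \o rf ps) e) (Some \o rf') ->
  (forall fw, fw_le (fw_step fw e) fw) ->
  (forall a, sb_view (sb ps) a = NotFound ->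
    fits (mem_lds a r) (history a ib' (m a))) ->
  proc_inv p i G m mrb (Proc (pcr ps) rf' r (sb ps) (lf ps) (nxt ps)) w' ib'.
Proof.
move=> Inv E Hfl Epc Erf Esb Eib Hrv Hfw Hfits.
rewrite -[sb ps]cats0; apply: (proc_inv_pop (s := [::]) Inv E) => //.
- by rewrite cats0 Esb (pi_sb Inv).
- by rewrite cats0; apply: Hfw.
- by rewrite cats0.
Qed.

Lemma eq_fwith (f g : R -> V) d v : f =1 g ->
  [eta f with d |-> v] =1 [eta g with d |-> v].
Proof. by move=> fg r /=; rewrite fg. Qed.

Lemma rv_le_write (f : R -> V) e d v :
  ins_write (e_ins e) = Some (d, Some v) ->
  rv_le (rv_step (Some \o f) e) (Some \o [eta f with d |-> v]).
Proof.
move=> E r u; rewrite /rv_step E /= eq_sym.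
by case: (r =P d).
Qed.

Lemma proc_inv_commit p i G m mrb ps w ib ev req ps' wm :
  (forall a, wm a = (m a).1) -> proc_inv p i G m mrb ps w ib ->
  ooo_rule p i ps (Some ev) req ps' ->
  req = None /\ exists w' ib', wmm_exec p wm w ev w' /\
    proc_inv p i G m mrb ps' w' ib'.
Proof.
move=> Hm Inv; move El: (Some ev) => l H; case: H El => // [
  idx pc npc x val r E [->]|idx pc npc x a v t r E [->]|idx pc npc r E [->]|
  idx pc npc x a v t r E [->]|idx pc npc ex r E Esb [->]]; split=> //.
all: have := pi_rob Inv; rewrite {1}E /= => -[/= Epc ok ok2].
all: have Hfit0 := pi_fits Inv; rewrite E /= in Hfit0.
- case: ok => /= Hf [vs [v [/(map_SomeK (pi_rf Inv)) Evs [Ev] Hop]]].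
  subst v vs pc; eexists _, ib; split; first exact: (WMM_Nm wm Hf Hop).
  apply: (proc_inv_pop0 Inv E) => //=.
  + exact: eq_fwith (pi_rf Inv).
  + exact: (pi_ib Inv).
  + exact: rv_le_write.
  + by move=> fw b; constructor 1.
- case: ok => /= Hf Hnpc Ha [_ [_ [t' [[<-] [<-] Et Gt Hfw]]]]; subst t npc pc.
  have [vs /(map_SomeK (pi_rf Inv)) Evs Eas] := Ha _ erefl; subst vs.
  have Hrf : [eta w_rf w with ld_dst x |-> v] =1
      [eta rf ps with ld_dst x |-> v].
    exact: eq_fwith (pi_rf Inv).
  have Hrv : rv_le (rv_step (Some \o rf ps) (Entry (w_pc w) (seqpc p (w_pc w))
      (RLd x (Some a) (Some v) (Some t')) Done))
      (Some \o [eta rf ps with ld_dst x |-> v]).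
    exact: rv_le_write.
  have other b h : b != a -> sb_view (sb ps) b = NotFound ->
      h = history b ib (m b) -> fits (mem_lds b r) h.
    by move=> Hb /Hfit0 + ->; rewrite /done_ld /= eq_sym (negPf Hb).
  case: Hfw => Hview.
    have := sb_view_cases (sb ps) a; rewrite Hview.
    case=> s1 [s [s2 [Es Esa Esv _ Hs2]]].
    have Ewsb : w_sb w = [seq (sb_a s, sb_v s) | s <- s1] ++
        (a, v) :: [seq (sb_a s, sb_v s) | s <- s2].
      by rewrite (pi_sb Inv) Es map_cat /= Esa Esv.
    eexists _, ib; split.
      by apply: (WMM_LdSb wm Hf Eas Ewsb); rewrite /has_addr -map_comp.
    apply: (proc_inv_pop0 Inv E) => //=; first exact: (pi_ib Inv).
      by move=> fw b; constructor 1.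
    move=> b; case: (altP (b =P a)) => [->|Hb Hview']; first by rewrite Hview.
    exact: other.
  have Hno : ~~ has_addr a (w_sb w).
    by rewrite /has_addr (pi_sb Inv) -map_comp; apply/sb_view_NotFound.
  have := Hfit0 _ Hview; rewrite /done_ld /= eqxx /=.
  move=> Hv; have [h1 [h2 [Eh Hh2]]] := fits_cons_inv Hv.
  have Ewib : forall s : seq (A * (V * tag)),
      without a [seq (y.1, y.2.1) | y <- s] =
      [seq (y.1, y.2.1) | y <- s & y.1 != a].
    by move=> s; rewrite /without filter_map.
  (* The position of the value in the history selects the WMM rule: the last place is memory, any
     other an invalidation entry. Either rule discards exactly what precedes the value, and by [Hh2]
     the remaining loads still fit. *)
  move: Eh Hh2; case/lastP: h2 => [|h2 y].
    rewrite cats1 => /rcons_inj [_ Em] Hh2.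
    have Ev : v = wm a by rewrite Hm Em.
    rewrite Ev in Hrf Hrv *; eexists _, [seq y <- ib | y.1 != a]; split.
      exact: (WMM_LdMem wm Hf Eas Hno).
    apply: (proc_inv_pop0 Inv E) => //=.
    + by rewrite (pi_ib Inv) Ewib.
    + by rewrite -Ev in Hrv *.
    + by move=> fw b; constructor 1.
    + move=> b; case: (altP (b =P a)) => [->|Hb Hview'].
        by rewrite history_without eqxx Em.
      by apply: other => //; rewrite history_without (negPf Hb).
  rewrite -rcons_cons -rcons_cat => /rcons_inj [Eh Em] Hh2.
  have [ib1 [ib2 [Eib Eib2]]] := filter_split Eh.
  eexists _, ([seq y <- ib1 | y.1 != a] ++ (a, (v, t')) :: ib2); split.
    apply: (@WMM_LdIb _ _ _ _ _ wm w x a v [seq (y.1, y.2.1) | y <- ib1]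
      [seq (y.1, y.2.1) | y <- ib2] Hf Eas Hno).
    by rewrite (pi_ib Inv) Eib map_cat.
  apply: (proc_inv_pop0 Inv E) => //=.
  + by rewrite map_cat Ewib.
  + by move=> fw b; constructor 1.
  + move=> b; case: (altP (b =P a)) => [->|Hb Hview'].
      rewrite /history filter_cat -filter_predI.
      rewrite (eq_filter (a2 := pred0)) ?filter_pred0; last first.
        by move=> z /=; case: eqP.
      by rewrite /= eqxx /= Eib2 Em.
    apply: other => //; rewrite Eib /history !filter_cat -filter_predI /=.
    congr (rcons (map _ (_ ++ _)) _); apply: eq_filter => z /=.
    by case: eqP => // ->; rewrite Hb.
- case: ok => /= Hf Hnpc; subst npc pc.
  eexists _, [::]; split; first exact: (WMM_Rec wm Hf).
  apply: (proc_inv_pop0 Inv E) => //=; first exact: (pi_rf Inv).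
    by move=> fw b; constructor 2.
  (* Behind the Reconcile every search starts from [Blocked], which no collected load tolerates. So
     emptying the invalidation buffer takes nothing from a waiting load. *)
  move=> b _; suff -> : mem_lds b r = [::] by constructor.
  case Er: (mem_lds b r) => [//|y s]; have Hy : y \in mem_lds b r.
    by rewrite Er inE eqxx.
  by have [_ []] := mem_lds_ok ok2 Hy.
- case: ok => /= Hf Hnpc Et [vs /(map_SomeK (pi_rf Inv)) Evs [[Ea] [Ev] Gt]].
  subst vs npc pc; eexists _, [seq y <- ib | y.1 != a]; split.
    exact: (WMM_St wm Hf Ea Ev).
  rewrite /set_sb /= -cats1; apply: (proc_inv_pop Inv E) => //=.
  + exact: (pi_rf Inv).
  + by rewrite -cats1 (pi_sb Inv) map_cat.
  + by rewrite (pi_ib Inv) /without filter_map.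
  + move=> b; constructor 1; rewrite fw_step_rec sb_view_cat sb_view1 /=.
    by case: eqP.
  + by rewrite Gt Ev eqxx.
  + move=> b; rewrite sb_view_cat sb_view1 /= history_without eq_sym.
    case: eqP => // Hb /Hfit0; rewrite /stops fw_step_rec /=.
    by case: eqP Hb => // ->.
- case: ok => /= Hf Hnpc; subst npc pc.
  eexists _, ib; split.
    by apply: (WMM_Com wm Hf); rewrite (pi_sb Inv) Esb.
  apply: (proc_inv_pop0 Inv E) => //=; first exact: (pi_rf Inv).
  + exact: (pi_ib Inv).
  + by move=> fw b; constructor 1.
Qed.

(** * Writes to memory and the simulation *)

Lemma filter_nonempty {T} (q : pred T) s x : ohead (filter q s) = Some x ->
  exists s1 s2, [/\ s = s1 ++ x :: s2, all (predC q) s1 & q x].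
Proof.
elim: s => //= y s IH; case: (boolP (q y)) => [Hy [<-]|Hy /IH].
  by exists [::], s.
by case=> s1 [s2 [-> H1 H2]]; exists (y :: s1), s2; split=> //=; rewrite Hy.
Qed.

Lemma rem_oldest_cat {T} (q : pred T) s1 x s2 : all (predC q) s1 -> q x ->
  rem_oldest q (s1 ++ x :: s2) = s1 ++ s2.
Proof.
move=> H1 Hx; rewrite /rem_oldest find_cat /= Hx addn0.
rewrite -[has _ _]negbK -all_predC H1 /=.
by rewrite take_size_cat // -cat_rcons drop_size_cat ?size_rcons.
Qed.

Lemma proc_inv_respSt p i G m b1 b2 ps w ib a v t :
  proc_inv p i G m (b1 ++ ReqSt a v t :: b2) ps w ib ->
  G t = Some v /\ exists sb1 sb2, [/\ w_sb w = sb1 ++ (a, v) :: sb2,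
    ~~ has_addr a sb1
    & proc_inv p i G [eta m with a |-> (v, t)] (b1 ++ b2) (respSt ps a)
        (WmmProc (w_pc w) (w_rf w) (sb1 ++ sb2) (w_ib w)) ib].
Proof.
case=> HI Hn ok Hrf Hsb Hib Hf HG fr Hp Hu Hs Hsu.
have Hreq : (a, (v, t)) \in pmap st_req (b1 ++ ReqSt a v t :: b2).
  by rewrite pmap_cat mem_cat /= inE eqxx orbT.
have [s1 [s2 [E H1 _]]] := filter_nonempty (Hs _ _ _ Hreq).
have Gt : G t = Some v by move: HG; rewrite E all_cat /= => /and3P [_ /eqP].
have view b : sb_view (sb ps) b = if sb_view s2 b is Hit u t' then Hit u t'
    else if a == b then Hit v t else sb_view s1 b.
  by rewrite E -cat1s !sb_view_cat sb_view1 /=; case: (a == b); case: sb_view.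
have none : a \notin [seq sb_a s | s <- s1].
  have : all (fun b => b != a) [seq sb_a s | s <- s1] by rewrite all_map.
  by apply: contraL => Ha; apply/allPn; exists a; rewrite // negbK.
split=> //; exists [seq (sb_a s, sb_v s) | s <- s1],
  [seq (sb_a s, sb_v s) | s <- s2].
split; [by rewrite Hsb E map_cat|by rewrite /has_addr -map_comp|].
have view' b : sb_view (s1 ++ s2) b = if b == a then
    (if sb_view s2 b is Hit u t' then Hit u t' else NotFound)
    else sb_view (sb ps) b.
  rewrite view sb_view_cat [a == b]eq_sym; case: eqP => // ->.
  by case: sb_view => //; apply/sb_view_NotFound.
rewrite /respSt E rem_oldest_cat //=.
have uniq_a b u t' : (b, (u, t')) \in pmap st_req (b1 ++ b2) -> b != a.
  move=> H; move: Hsu; rewrite pmap_cat /unzip1 map_cat /= -cat1s uniq_catCA /=.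
  case/andP => + _; rewrite -map_cat -pmap_cat; apply: contraNneq => <-.
  by apply/mapP; exists (b, (u, t')).
split=> //=.
(* The view changes at most at [a], and then from a hit to [NotFound], as [fw_le] permits. *)
- apply: rob_ok_le ok => // b; rewrite view' view.
  case: (b =P a) => [->|_]; last by constructor 1; rewrite -view.
  by case: sb_view => [u t'||]; [constructor 1|constructor 3|constructor 3].
- by rewrite map_cat.
- move=> b; rewrite view'; case: (b =P a) => [->|_]; last exact: Hf.
  move=> Ev; have Hit_a : sb_view (sb ps) a = Hit v t.
    by rewrite view eqxx; case: sb_view Ev.
  (* The condition for [a] now becomes active. While the departing store was buffered, it was the
     only value the collected loads could have, and it has just become the memory value. *)
  have -> : mem_lds a (rob ps) = nseq (size (mem_lds a (rob ps))) (v, t).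
    apply/all_pred1P/allP => y /(mem_lds_ok ok) [_ +].
    rewrite Hit_a => -[|//] [-> ->].
    by rewrite /= -surjective_pairing.
  exact: (fits_rcons _ (FitsNil _)).
- by move: HG; rewrite E !all_cat /= => /and3P [-> _ ->].
- move=> k b H; apply: Hp; move: H; rewrite !pmap_cat //.
- by move: Hu; rewrite !pmap_cat.
- move=> b u t' H; have := uniq_a _ _ _ H; move: H.
  rewrite pmap_cat mem_cat => H Hb; rewrite -(Hs b u t').
    by rewrite E !filter_cat /= eq_sym (negPf Hb).
  by rewrite pmap_cat mem_cat /= inE; case/orP: H => ->; rewrite ?orbT.
- move: Hsu; rewrite !pmap_cat /unzip1 !map_cat /= -cat1s uniq_catCA /=.
  by case/andP.
Qed.

(** The overwritten pair passes from the end of the history into the invalidation buffer and [x]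
    follows it, so the old history is a prefix of the new one. If the store buffer contains [a],
    nothing is inserted, but then [pi_fits] is void for [a]. *)
Lemma proc_inv_other p j G m mrb ps w ib a x :
  proc_inv p j G m mrb ps w ib ->
  exists ib', proc_inv p j G [eta m with a |-> x] mrb ps
    (invalidate a (m a).1 w) ib'.
Proof.
case=> HI Hn ok Hrf Hsb Hib Hf HG fr Hp Hu Hs Hsu.
have Haddr : has_addr a (w_sb w) = (a \in [seq sb_a s | s <- sb ps]).
  by rewrite /has_addr Hsb -map_comp.
rewrite /invalidate Haddr; case: ifP => [Ha|_].
  exists ib; split=> // b /=; case: eqP => [->|_]; last exact: Hf.
  by move/sb_view_NotFound; rewrite Ha.
exists (rcons ib (a, m a)); split=> //=; first by rewrite map_rcons Hib.
move=> b; rewrite /history filter_rcons /= [a == b]eq_sym.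
case: eqP => [->|_] /Hf // H.
by rewrite map_rcons /= -[rcons (rcons _ _) _]cats1; apply: fits_catr.
Qed.

Lemma proc_inv_tags p j G G' m mrb ps w ib :
  (forall t v, G t = Some v -> G' t = Some v) ->
  (forall k, G' (inr (j, k)) = G (inr (j, k))) ->
  proc_inv p j G m mrb ps w ib -> proc_inv p j G' m mrb ps w ib.
Proof.
move=> leG eqG [HI Hn ok Hrf Hsb Hib Hf HG fr Hp Hu Hs Hsu]; split=> //.
- by apply: rob_ok_mono ok => // [k _|b]; [rewrite eqG|constructor 1].
- by apply: sub_all HG => s /eqP /leG ->.
- by move=> k /fr; rewrite eqG.
Qed.

Lemma proc_inv_step p i G m mrb ps w ib req ps' :
  proc_inv p i G m mrb ps w ib -> ooo_rule p i ps None req ps' ->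
  exists G', [/\ forall t v, G t = Some v -> G' t = Some v,
    forall j k, j != i -> G' (inr (j, k)) = G (inr (j, k))
    & proc_inv p i G' m (mrb ++ seq_of_opt req) ps' w ib].
Proof.
move=> Inv; move El: None => l H; case: H El => //.
- move=> npc idx H1 H2 _; exists G; split=> //; rewrite cats0.
  exact: proc_inv_fetch.
- move=> idx pc npc x val0 vs nextpc val H1 H2 H3 _; exists G; split=> //.
  by rewrite cats0; apply: proc_inv_NmEx H1 H2 H3.
- move=> idx pc npc x v t vs H1 H2 _; exists G; split=> //.
  by rewrite cats0; apply: proc_inv_LdAddr H1 H2.
- move=> idx pc npc x a ex v H1 _; exists G; split=> //.
  by rewrite cats0; apply: proc_inv_LdPred H1.
- move=> idx pc npc x a v vs res t H1 H2 H3 _; exists G; split=> //.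
  by rewrite cats0; apply: proc_inv_LdBypass H1 H2 H3.
- move=> idx pc npc x a v vs H1 H2 H3 H4 _; exists G; split=> //.
  exact: proc_inv_LdReq H1 H2 H3 H4.
- move=> idx pc npc x a0 v0 t vs H1 H2 _; rewrite cats0.
  exact: proc_inv_StEx H1 H2.
- move=> sb1 a v t sb2 H1 H2 _; exists G; split=> //.
  exact: proc_inv_StReq H1 H2.
Qed.

Definition sim_inv (P : 'I_n -> program A V R PC) (s : @ooo_ccm A V R PC n)
    (w : @wmm A V R PC n) : Prop :=
  exists G ib, [/\ forall a, w_m w a = (ccm_m (oc_mem s) a).1,
    forall a, G (ccm_m (oc_mem s) a).2 = Some (ccm_m (oc_mem s) a).1
    & forall i, proc_inv (P i) i G (ccm_m (oc_mem s)) (ccm_mrb (oc_mem s) i)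
        (oc_proc s i) (w_proc w i) (ib i)].

Lemma sim_step P s w o s' : sim_inv P s w -> ooo_ccm_step P s o s' ->
  exists w', sim_inv P s' w' /\ (o = None /\ w' = w \/ wmm_step P w o w').
Proof.
case=> G [ib [Hm Gm Inv]]; case.
- move=> i [ev|] req ps' H /=.
    have [-> [w' [ib' [Hw Inv']]]] := proc_inv_commit Hm (Inv i) H.
    exists (Wmm [eta w_proc w with i |-> w'] (w_m w)); split; last first.
      by right; constructor.
    exists G, [eta ib with i |-> ib']; split=> // j /=.
    by case: eqP => [->|_]; rewrite ?cats0.
  have [G' [leG eqG Inv']] := proc_inv_step (Inv i) H.
  exists w; split; last by left.
  exists G', ib; split=> // [a|j /=]; first by rewrite /= (leG _ _ (Gm a)).
  case: (altP (j =P i)) => [->|Hj] //.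
  by apply: (proc_inv_tags leG _ (Inv j)) => k; apply: eqG.
- move=> i idx a b1 b2 v t Hreq Ha; exists w; split; last by left.
  exists G, ib; split=> // j /=; case: (altP (j =P i)) => [->|Hj] //.
  have Ev : v = (ccm_m (oc_mem s) a).1 by rewrite Ha.
  have Et : t = (ccm_m (oc_mem s) a).2 by rewrite Ha.
  rewrite Ev Et; apply: proc_inv_respLd; first exact: Gm.
  by rewrite -Hreq.
- move=> i a v t b1 b2 Hreq.
  have := Inv i; rewrite Hreq => /proc_inv_respSt.
  case=> Gt [sb1 [sb2 [Ew Hsb1 Inv']]].
  exists (Wmm (fun j => let w0 := w_proc w j in
      if j == i then WmmProc (w_pc w0) (w_rf w0) (sb1 ++ sb2) (w_ib w0)
      else invalidate a (w_m w a) w0) [eta w_m w with a |-> v]).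
  split; last first.
    by right; apply: WMM_DeqSb Ew Hsb1.
  have Hib j : exists ib', proc_inv (P j) j G
      [eta ccm_m (oc_mem s) with a |-> (v, t)] (ccm_mrb (oc_mem s) j)
      (oc_proc s j) (invalidate a (w_m w a) (w_proc w j)) ib'.
    by rewrite Hm; apply: proc_inv_other (Inv j).
  (* Finiteness of the set of processors replaces choice in collecting the decorated buffers. *)
  have [ib' {}Hib] := fin_all_exists Hib.
  exists G, [eta ib' with i |-> ib i]; split=> [b|b|j] /=.
  + by case: eqP.
  + by case: eqP.
  + by case: (altP (j =P i)) => [->|Hj].
Qed.

(** Initially the ghost map knows just the tags [inl a] of the initial memory. *)
Lemma sim_init P I : sim_inv P (ooo_ccm_init I) (wmm_init I).
Proof.
exists (fun t : tag => if t is inl a then Some (init_mem I a) else None).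
exists (fun _ => [::]); split=> // i; split=> //= a _; constructor.
Qed.

Lemma sim_exec P I ls s : exec (ooo_ccm_step P) (ooo_ccm_init I) ls s ->
  exists w, exec (wmm_step P) (wmm_init I) ls w /\ sim_inv P s w.
Proof.
elim=> [|{}ls {}s l s' _ [w [Hw Hinv]] Hs].
  by exists (wmm_init I); split; [constructor | apply: sim_init].
have [w' [Hinv' H]] := sim_step Hinv Hs; exists w'; split=> //.
case: H => [[-> ->]|H]; [by rewrite cats0 | exact: ExecStep Hw H].
Qed.

End Simulation.

Theorem theorem1 (A V R PC : eqType) (n : nat)
    (P : 'I_n -> program A V R PC) (I : init_state A V R PC n) :
  forall b : behavior A V R PC n,
    ooo_ccm_behavior P I b -> wmm_behavior P I b.
Proof.
move=> b [ls [s [Hex Hsb Htr Hmem]]].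
have [w [Hw [G [ib [Hm _ Inv]]]]] := sim_exec Hex.
exists ls, w; split=> // [i|a]; last by rewrite Hmem Hm.
by rewrite (pi_sb (Inv i)) Hsb.
Qed.
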